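(* Suppose that there are no $\theta^\dagger$-conflicting agents, i.e. $\mathcal N^C(\theta^\dagger)=\emptyset$. Let $\Phi^\star$ be the maximum error exponent in the optimization problem $\max_{\pi\in\Pi}\Phi(\pi)$ and let $\Pi^\star$ be the set of optimal Perron eigenvectors (the maximizers). Define $$\Pi_1=\big\{\pi\in\Pi:\Phi(\pi,\theta^\dagger)\le\Phi(\pi,\theta)\ \ \forall\theta\neq\theta_1\big\},$$ $$\Pi_2=\big\{\pi:\ \exists\,\alpha>0\text{ such that }\pi_k=\alpha\,\pi_k^\dagger\ \ \forall k\notin\mathcal N^U(\theta^\dagger)\big\},\qquad \Pi^\dagger=\Pi_1\cap\Pi_2,$$ where $\pi_k^\dagger=t_k^{\mathsf{nc}}(\theta^\dagger)\big/\sum_{\ell=1}^Nt_\ell^{\mathsf{nc}}(\theta^\dagger)$ for $k\in\mathcal N$. If $\Pi^\dagger\neq\emptyset$, then the upper bound of the error exponent is achieved, i.e. $\Phi^\star=\Phi^{\mathsf{nc}}_{\Sigma}(\theta^\dagger)$, and the corresponding optimal set is $\Pi^\star=\Pi^\dagger$. Otherwise, $\Phi^\star<\Phi^{\mathsf{nc}}_{\Sigma}(\theta^\dagger)$.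
   Context: There are $N$ agents $\mathcal N=\{1,\dots,N\}$ and a hypothesis set $\Theta=\{\theta_1,\dots,\theta_H\}$ with true state $\theta_1$. At each time $i=1,2,\dots$ agent $k$ receives a signal $\xi_{k,i}\in\mathcal X_k$ with distribution $f_k$ (a pdf or pmf); the signals are independent over agents and over time. Agent $k$ has likelihood models $L_k(\cdot|\theta)$, $\theta\in\Theta$ (pdfs or pmfs, of the same type as $f_k$), with the same support $\mathcal X_k$ as $f_k$; $f_k$ need not equal any $L_k(\cdot|\theta)$. Put $x_{k,i}(\theta)=\log\frac{L_k(\xi_{k,i}|\theta_1)}{L_k(\xi_{k,i}|\theta)}$, $d_k(\theta)=\mathbb E[x_{k,i}(\theta)]=D_{\mathrm{KL}}(f_k\|L_k(\cdot|\theta))-D_{\mathrm{KL}}(f_k\|L_k(\cdot|\theta_1))$, and $\Lambda_k(t;\theta)=\log\mathbb E[e^{tx_{k,i}(\theta)}]$, with expectations with respect to $f_k$. Standing assumptions: all $D_{\mathrm{KL}}(f_k\|L_k(\cdot|\theta))$ are finite; $\Lambda_k(t;\theta)<\infty$ for all $t\in\mathbb R$, $k\in\mathcal N$, $\theta\ne\theta_1$; identifiability: with $\Theta_k^\star=\arg\min_{\theta\in\Theta}D_{\mathrm{KL}}(f_k\|L_k(\cdot|\theta))$ and $\mathcal N_A=\{k:\theta_1\in\Theta_k^\star\}$, one has $\bigcap_{k\in\mathcal N_A}\Theta_k^\star=\{\theta_1\}$. The set of feasible Perron eigenvectors is $$\Pi=\Big\{\pi\in\mathbb R^N:\ \textstyle\sum_k\pi_k=1,\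 \pi_k>0\ \forall k,\ \ \sum_{k=1}^N\pi_kd_k(\theta)>0\ \ \forall\theta\neq\theta_1\Big\}.$$ For $\pi\in\Pi$ and $\theta\ne\theta_1$ put $\Lambda_{\mathsf{ave}}(t;\pi,\theta)=\sum_{k=1}^N\Lambda_k(\pi_kt;\theta)$, $\phi(t;\pi,\theta)=\int_0^t\frac{\Lambda_{\mathsf{ave}}(\tau;\pi,\theta)}{\tau}d\tau$ (integrand extended by continuity at $0$), $\Phi(\pi,\theta)=-\inf_{t\in\mathbb R}\phi(t;\pi,\theta)$ and $\Phi(\pi)=\min_{\theta\ne\theta_1}\Phi(\pi,\theta)$. For $\theta\neq\theta_1$ the agents are classified as: uninformative, $\mathcal N^U(\theta)=\{k:\Lambda_k(t;\theta)=0\ \forall t\in\mathbb R\}$; informative, $\mathcal N^I(\theta)=\{k\notin\mathcal N^U(\theta):d_k(\theta)>0\}$; conflicting, $\mathcal N^C(\theta)=\{k\notin\mathcal N^U(\theta):d_k(\theta)\le0\}$. Non-cooperative quantities: $\phi_k^{\mathsf{nc}}(t;\theta)=\int_0^t\frac{\Lambda_k(\tau;\theta)}{\tau}d\tau$. The non-cooperative error exponent is $\Phi_k^{\mathsf{nc}}(\theta)=-\lim_{\delta\to0}\delta\ln\mathbb P\big[\delta\sum_{m=0}^\infty(1-\delta)^mx_{k,m+1}(\theta)\le0\big]$; it equals $-\inf_{t\in\mathbb R}\phi_k^{\mathsf{nc}}(t;\theta)$ for $k\in\mathcal N^I(\theta)$ and $0$ for $k\notin\mathcal N^I(\theta)$.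 The critical value $t_k^{\mathsf{nc}}(\theta)\le 0$ satisfies $\Phi_k^{\mathsf{nc}}(\theta)=-\phi_k^{\mathsf{nc}}(t_k^{\mathsf{nc}}(\theta);\theta)$: for $k\in\mathcal N^I(\theta)$ it is the unique nonzero (necessarily negative) solution $t$ of $\Lambda_k(t;\theta)=0$; for $k\in\mathcal N^U(\theta)$ it is set to $-C$, where $C>0$ is an arbitrary fixed constant that may depend on $k,\theta$; for $k\in\mathcal N^C(\theta)$ it is $0$. Put $\Phi^{\mathsf{nc}}_\Sigma(\theta)=\sum_{k=1}^N\Phi_k^{\mathsf{nc}}(\theta)$ and $\theta^\dagger=\arg\min_{\theta\ne\theta_1}\Phi^{\mathsf{nc}}_\Sigma(\theta)$, where it is assumed that this minimizer is unique. For every $\pi\in\Pi$ one has the upper bound $\Phi(\pi)\le\Phi^{\mathsf{nc}}_\Sigma(\theta^\dagger)$. *)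

(* Defs.v *)
From HB Require Import structures.
From mathcomp Require Import all_boot all_order all_algebra.
From mathcomp Require Import all_classical all_reals all_analysis.
Import Order.TTheory GRing.Theory Num.Theory.
Import numFieldNormedType.Exports.

Set Implicit Arguments.
Unset Strict Implicit.
Unset Printing Implicit Defensive.

Local Open Scope classical_set_scope.
Local Open Scope ring_scope.

(* [f k] and [L k th] are densities with respect to the reference measure
   [mu k]: Lebesgue measure gives pdfs, counting measure gives pmfs.  The common
   support of [f k] and the [L k th] is the set where they do not vanish, which
   may be smaller than the carrier [X k].
   There are H.+1 hypotheses; the true state theta_1 is [ord0]. *)
Record model (R : realType) (N H : nat) := Model {
  disp : 'I_N -> measure_display ;
  X : forall k, measurableType (disp k) ;
  mu : forall k, {sigma_finite_measure set (X k) -> \bar R} ;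
  f : forall k, X k -> R ;
  L : forall k, 'I_H.+1 -> X k -> R }.

Definition theta1 (H : nat) : 'I_H.+1 := ord0.
Arguments theta1 {H}.

Section Definitions.
Context {R : realType} {N H : nat} (S : model R N H).
Implicit Types (k : 'I_N) (th : 'I_H.+1) (t : R) (p : 'rV[R]_N).

Definition is_density k (g : X S k -> R) : Prop :=
  [/\ measurable_fun [set: X S k] g, (forall s, 0 <= g s) &
      (\int[mu S k]_s (g s)%:E = 1)%E].

Definition expect k (g : X S k -> R) : \bar R :=
  (\int[mu S k]_s (f s * g s)%:E)%E.

Definition llr k th (s : X S k) : R := ln (L theta1 s / L th s).

Definition KL k th : \bar R := expect (fun s : X S k => ln (f s / L th s)).

Definition drift k th : R := fine (expect (@llr k th)).

Definition mgf k th t : \bar R :=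
  expect (fun s : X S k => expR (t * llr th s)).

Definition Lambda k th t : R := ln (fine (mgf k th t)).

Definition Theta_star k : set 'I_H.+1 :=
  [set th | forall th', (KL k th <= KL k th')%E].

Definition N_A : set 'I_N := [set k | Theta_star k theta1].

Record standing_assumptions : Prop := StandingAssumptions {
  f_density : forall k, is_density (@f _ _ _ S k) ;
  L_density : forall k th, is_density (@L _ _ _ S k th) ;
  same_support : forall k th (s : X S k), (L th s == 0) = (f s == 0) ;
  KL_finite : forall k th, KL k th \is a fin_num ;
  mgf_finite : forall k th t, th != theta1 -> (mgf k th t < +oo)%E ;
  identifiability : \bigcap_(k in N_A) Theta_star k = [set theta1] }.

(* Time is shifted by one: [xi k m] is the signal of agent k at time m.+1. *)
Record signals d (Omega : measurableType d) (P : probability Omega R)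
    (xi : forall k, nat -> Omega -> X S k) : Prop := Signals {
  signal_measurable : forall k m, measurable_fun [set: Omega] (xi k m) ;
  signal_law : forall k m (A : set (X S k)), measurable A ->
    P (xi k m @^-1` A) = (\int[mu S k]_(s in A) (f s)%:E)%E ;
  signal_independent : forall (J : seq ('I_N * nat)) (A : forall k, nat -> set (X S k)),
    uniq J -> (forall k m, measurable (A k m)) ->
    P (\big[setI/setT]_(j <- J) (xi j.1 j.2 @^-1` A j.1 j.2)) =
      (\prod_(j <- J) P (xi j.1 j.2 @^-1` A j.1 j.2))%E }.

Definition extend0 (g : R -> R) : R -> R :=
  fun x => if x == 0 then lim (g @ 0^') else g x.

Definition integral0 (g : R -> R) t : R :=
  if 0 <= t then \int[lebesgue_measure]_(x in `[0, t]) g x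
  else - \int[lebesgue_measure]_(x in `[t, 0]) g x.

Definition Pi : set 'rV[R]_N :=
  [set p | [/\ \sum_k p ord0 k = 1, (forall k, 0 < p ord0 k) &
    forall th, th != theta1 -> 0 < \sum_k p ord0 k * drift k th]].

Definition Lambda_ave p th t : R := \sum_k Lambda k th (p ord0 k * t).

Definition phi p th t : R :=
  integral0 (extend0 (fun x => Lambda_ave p th x / x)) t.

(* The infimum is finite under the standing assumptions: when it is not
   identically 0, [Lambda k th] tends to +oo at both ends, because two densities
   with the same support cannot be strictly ordered on it. *)
Definition Phi_th p th : R := - inf [set phi p th t | t in [set: R]].

(* Infimum over a finite set, hence a minimum. *)
Definition Phi p : R := inf [set Phi_th p th | th in [set th | th != theta1]].

Definition uninformative th k : Prop := forall t, Lambda k th t = 0.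

Definition informative th k : Prop := ~ uninformative th k /\ 0 < drift k th.

Definition conflicting th k : Prop := ~ uninformative th k /\ drift k th <= 0.

Definition t_nc (C : 'I_N -> 'I_H.+1 -> R) k th : R :=
  if `[< informative th k >] then
    get [set t : R | t != 0 /\ Lambda k th t = 0]
  else if `[< uninformative th k >] then - C k th
  else 0.

Section NonCooperative.
Context {d : measure_display} {Omega : measurableType d}
  (P : probability Omega R) (xi : forall k, nat -> Omega -> X S k).

(* The series converges almost surely; off that event [limn] is a default. *)
Definition nc_event k th (delta : R) : set Omega :=
  [set w | delta * limn (series (fun m => (1 - delta) ^+ m * llr th (xi k m w)))
           <= 0].

Definition Phi_nc k th : R :=
  - lim ((fun delta : R => delta * ln (fine (P (nc_event k th delta)))) @ 0^'+).

Definition Phi_nc_sum th : R := \sum_k Phi_nc k th.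

Definition unique_minimizer th : Prop :=
  th != theta1 /\
  forall th', th' != theta1 -> th' != th -> Phi_nc_sum th < Phi_nc_sum th'.

End NonCooperative.

(* [Pi] is not closed, so the maximum need not exist; [is_max_exponent v] says
   that it does and equals v. *)
Definition is_max_exponent (v : R) : Prop :=
  (exists2 p, Pi p & Phi p = v) /\ (forall p, Pi p -> Phi p <= v).

Definition Pi_star : set 'rV[R]_N :=
  [set p | Pi p /\ forall q, Pi q -> Phi q <= Phi p].

Definition pi_dagger (C : 'I_N -> 'I_H.+1 -> R) thd k : R :=
  t_nc C k thd / \sum_l t_nc C l thd.

Definition Pi_1 thd : set 'rV[R]_N :=
  [set p | Pi p /\ forall th, th != theta1 -> Phi_th p thd <= Phi_th p th].

Definition Pi_2 (C : 'I_N -> 'I_H.+1 -> R) thd : set 'rV[R]_N :=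
  [set p | exists2 alpha : R, 0 < alpha &
    forall k, ~ uninformative thd k -> p ord0 k = alpha * pi_dagger C thd k].

Definition Pi_dagger C thd : set 'rV[R]_N := Pi_1 thd `&` Pi_2 C thd.

End Definitions.

(* Main.v *)
(* Since [Phi p <= Phi_th p thd], it suffices to study the hypothesis [thd].  With
   [phi_k] the integral of [Lambda_k / t], one has
   [Phi_th p thd = - inf_t \sum_k phi_k (p_k t)], which is at most
   [\sum_k - inf phi_k], with equality iff all [p_k t] sit simultaneously at the
   minimizers [t_k]; these are unique for the informative agents, which makes [p]
   proportional to the critical values.

   The non-cooperative exponents are identified with [- inf phi_k] by a
   one-dimensional Gaertner-Ellis argument.  The points [t (1 - delta)^m] cut the
   segment from 0 to [t] geometrically, so delta times the logarithmic moment
   generating function of the discounted sum is a Riemann sum of [phi_k].  The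
   upper bound is Chernoff's; for the lower bound, outside of a window around
   the tilted mean [exp (t Z)] is dominated by [exp ((t + s) Z)] and
   [exp ((t - s) Z)], so no change of measure is needed. *)
Require Import Defs.
From HB Require Import structures.
From mathcomp Require Import all_boot all_order all_algebra.
From mathcomp Require Import all_classical all_reals all_analysis.
From mathcomp Require Import measurable_realfun measurable_fun_approximation.
From mathcomp Require Import ring lra.
Import Order.TTheory GRing.Theory Num.Theory.
Import numFieldNormedType.Exports.
Local Open Scope classical_set_scope.
Local Open Scope ring_scope.

Set Implicit Arguments.
Unset Strict Implicit.
Unset Printing Implicit Defensive.

(** * Laws and independence *)

(** A nonzero critical value exists because two densities cannot be ordered almost everywhere
    without agreeing. The log-likelihood ratio of an informative agent is therefore negative with
    positive probability, its moment generating function climbs back to 1 on the negative axis, and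
    convexity fixes the signs around that root.

    The large deviation estimate concerns an infinite series, whereas only the partial sums have a
    computable moment generating function. Egorov's theorem passes between the two at the price of a
    shifted threshold and an additive error. The error is removed by letting the number of terms
    grow while delta stays fixed, so it never competes with probabilities that are exponentially
    small in 1/delta. The lower bound needs room for the shift: the tilt is taken slightly to the
    left of the critical value, where the tilted mean is negative.

    An uninformative agent has [phi_k = 0], minimal everywhere, so its weight is left free; hence
    the restriction to the other agents in [Pi_2]. *)

Section WeightedIntegral.
Context {R : realType} d d2 (T : measurableType d) (T2 : measurableType d2).
Import HBNNSimple.
Variables (mu : {measure set T -> \bar R}) (W : T -> R) (X : T -> T2).
Hypotheses (mW : measurable_fun setT W) (W0 : forall x, 0 <= W x)
  (mX : measurable_fun setT X).

(** The weight makes the argument serve twice: it is the density [f k] when integrals move from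
    [Omega] to the signal space, and the product of the other factors in the proof of
    independence. *)
Lemma integral_weight_nnsfun (h : {nnsfun T2 >-> R}) :
  (\int[mu]_x (W x * h (X x))%:E =
  \sum_(r \in range h) r%:E * \int[mu]_x (W x * \1_(h @^-1` [set r]) (X x))%:E)%E.
Proof.
have mI r : measurable_fun setT (fun x => \1_(h @^-1` [set r]) (X x) : R).
  by apply: measurableT_comp => //; exact: measurable_indic.
under eq_integral => x _.
  rewrite fimfunE mulr_fsumr// -fsumEFin//.
  over.
rewrite ge0_integral_fsum//.
- apply: eq_fsbigr => r; rewrite inE => -[y _ hy].
  have r0 : 0 <= r by rewrite -hy.
  rewrite -ge0_integralZl_EFin//.
  + by apply: eq_integral => x _; rewrite mulrCA EFinM.
  + by move=> x _; rewrite lee_fin mulr_ge0.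
  + by apply/measurable_EFinP/measurable_funM.
- by move=> r; apply/measurable_EFinP/measurable_funM => //; apply: measurable_funM.
- move=> r x _; rewrite lee_fin mulr_ge0//.
  have [xr|xr] := eqVneq r (h (X x)).
  + by rewrite xr mulr_ge0.
  + rewrite indicE memNset ?mulr0//= => hr; by rewrite -hr eqxx in xr.
Qed.

Lemma integral_weight_lim (h : T2 -> R) (mh : measurable_fun setT (EFin \o h))
  (h0 : forall x, 0 <= h x) :
  (\int[mu]_x (W x * h (X x))%:E =
   limn (fun n => \int[mu]_x (W x * nnsfun_approx measurableT mh n (X x))%:E))%E.
Proof.
pose a := nnsfun_approx measurableT mh.
rewrite -monotone_convergence//.
- apply: eq_integral => x _; apply/esym/cvg_lim => //.
  under eq_fun do rewrite EFinM.
  rewrite EFinM; apply: cvgeZl => //.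
  by apply: cvg_nnsfun_approx => //= y _; rewrite lee_fin.
- move=> n; apply/measurable_EFinP/measurable_funM => //.
  by apply: measurableT_comp.
- by move=> n x _; rewrite lee_fin mulr_ge0.
- move=> x _ m n mn; rewrite lee_fin ler_wpM2l//.
  by have /lefP := nd_nnsfun_approx measurableT mh mn; exact.
Qed.
End WeightedIntegral.

Section ChangeOfLaw.
Context {R : realType} d d1 d2 (T : measurableType d) (T1 : measurableType d1)
  (T2 : measurableType d2).
Import HBNNSimple.

(* The law of [X] under [W mu] determines the integrals of the nonnegative
   functions of [X]. *)
Lemma eq_weighted_law (mu : {measure set T -> \bar R}) (nu : {measure set T1 -> \bar R})
  (W : T -> R) (V : T1 -> R) (X : T -> T2) (Y : T1 -> T2) (h : T2 -> R) :
  measurable_fun setT W -> (forall x, 0 <= W x) -> measurable_fun setT X ->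
  measurable_fun setT V -> (forall x, 0 <= V x) -> measurable_fun setT Y ->
  (forall B, measurable B ->
    \int[mu]_x (W x * \1_B (X x))%:E = \int[nu]_y (V y * \1_B (Y y))%:E)%E ->
  measurable_fun setT h -> (forall x, 0 <= h x) ->
  (\int[mu]_x (W x * h (X x))%:E = \int[nu]_y (V y * h (Y y))%:E)%E.
Proof.
move=> mW W0 mX mV V0 mY eqB /measurable_EFinP mh h0.
rewrite (integral_weight_lim mu mW W0 mX)// (integral_weight_lim nu mV V0 mY)//.
congr (limn _); apply/funext => n.
rewrite (integral_weight_nnsfun mu mW W0 mX)// (integral_weight_nnsfun nu mV V0 mY)//.
apply: eq_fsbigr => r _; rewrite eqB//; exact: measurable_funPTI.
Qed.
End ChangeOfLaw.

Section IndependentProduct.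
Context {R : realType} d (Omega : measurableType d) (P : probability Omega R).
Context d' (T : measurableType d').
Variable xi : nat -> Omega -> T.
Hypothesis mxi : forall m, measurable_fun setT (xi m).
Hypothesis ind : forall n (A : nat -> set T), (forall m, measurable (A m)) ->
  P (\big[setI/setT]_(m < n) (xi m @^-1` A m)) =
  (\prod_(m < n) P (xi m @^-1` A m))%E.

(* The indicators are exchanged for general nonnegative functions one index at
   a time. *)
Lemma integral_prod_indep (h : nat -> T -> R) n :
  (forall m, measurable_fun setT (h m)) -> (forall m x, 0 <= h m x) ->
  (forall m, \int[P]_w (h m (xi m w))%:E < +oo)%E ->
  (\int[P]_w (\prod_(m < n) h m (xi m w))%:E =
   \prod_(m < n) \int[P]_w (h m (xi m w))%:E)%E.
Proof.
have I_fin A m : measurable A -> (\int[P]_w (\1_A (xi m w))%:E < +oo)%E.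
  move=> mA; rewrite (_ : \int[P]_w _ = \int[P]_w (\1_(xi m @^-1` A) w)%:E)%E//.
  have mA' : measurable (xi m @^-1` A).
    by rewrite -[X in measurable X]setTI; exact: mxi.
  by rewrite integral_indic ?setIT// (le_lt_trans (probability_le1 _ _)) ?ltry.
(* Indices from [j] on carry indicators, those below [j] arbitrary functions: [j = 0] is
   independence of events, and [j = n] yields the claim. *)
suff key j : forall (h : nat -> T -> R),
  (forall m, measurable_fun setT (h m)) -> (forall m x, 0 <= h m x) ->
  (forall m, \int[P]_w (h m (xi m w))%:E < +oo)%E ->
  (forall m, (j <= m)%N -> exists2 A, measurable A & h m = \1_A) ->
  (\int[P]_w (\prod_(m < n) h m (xi m w))%:E =
   \prod_(m < n) \int[P]_w (h m (xi m w))%:E)%E.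
  (* Indices from [n] on do not occur in the product, so they may be reset to the indicator of the
     whole space. *)
  move=> mh h0 hf; pose h' m := if (m < n)%N then h m else \1_setT.
  have := key n h'; rewrite /h'.
  under eq_integral do under eq_bigr do rewrite ltn_ord.
  under eq_bigr do rewrite ltn_ord.
  apply.
  - by move=> m; case: ifP => // _; exact: measurable_indic.
  - by move=> m x; case: ifP.
  - by move=> m; case: ifP => // _; exact: I_fin.
  - by move=> m; rewrite ltnNge => -> /=; exists setT.
elim: j => [|j IH] {}h mh h0 hf hA.
  have /choice[A hA'] : forall m, exists A, measurable A /\ h m = \1_A.
    by move=> m; have [//|A mA hm] := hA m; exists A.
  have hE m w : h m (xi m w) = \1_(xi m @^-1` A m) w.
    by rewrite (hA' m).2.
  have mA m : measurable (xi m @^-1` A m).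
    by rewrite -[X in measurable X]setTI; apply: mxi => //; exact: (hA' m).1.
  under eq_integral => w _.
    under eq_bigr do rewrite hE.
    rewrite (_ : \prod_(m < n) _ = \1_(\big[setI/setT]_(m < n) (xi m @^-1` A m)) w).
      over.
    elim: n => [|n IHn]; first by rewrite !big_ord0 indicT.
    by rewrite !big_ord_recr/= IHn indicI.
  rewrite integral_indic ?setIT//; last first.
    by apply: bigsetI_measurable.
  apply: (etrans (@ind n A (fun m => (hA' m).1))).
  apply: eq_bigr => m _; under eq_integral do rewrite hE.
  by rewrite integral_indic ?setIT.
have [nj|jn] := leqP n j.
  pose h' m := if (m < n)%N then h m else \1_setT.
  have := IH h'; rewrite /h'.
  under eq_integral do under eq_bigr do rewrite ltn_ord.
  under eq_bigr do rewrite ltn_ord.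
  apply.
  - by move=> m; case: ifP => // _; exact: measurable_indic.
  - by move=> m x; case: ifP.
  - by move=> m; case: ifP => // _; exact: I_fin.
  - by move=> m jm; rewrite ltnNge (leq_trans nj jm) /=; exists setT.
pose J := Ordinal jn.
pose W w := \prod_(m < n | m != J) h m (xi m w).
have hge0 m : (0 <= \int[P]_w (h m (xi m w))%:E)%E.
  by apply: integral_ge0 => w _; rewrite lee_fin.
pose K := \prod_(m < n | m != J) fine (\int[P]_w (h m (xi m w))%:E)%E.
have K0 : 0 <= K by apply: prodr_ge0 => m _; rewrite fine_ge0.
have KE : (\prod_(m < n | m != J) \int[P]_w (h m (xi m w))%:E)%E = K%:E.
  rewrite /K -prodEFin; apply: eq_bigr => m _.
  by rewrite fineK// ge0_fin_numE.
have mW : measurable_fun setT W.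
  rewrite /W; rewrite (_ : (fun w => _) =
    (fun w => \prod_(m < n) (if m != J then h m (xi m w) else 1))); last first.
    by apply/funext => w; rewrite [LHS](@big_mkcond _ _ *%R).
  apply: (measurable_prod (h := fun (m : 'I_n) w => if m != J then h m (xi m w) else 1)).
  move=> i _ /=; case: (i != J); first exact: measurableT_comp.
  exact: measurable_cst.
have W0 w : 0 <= W w by apply: prodr_ge0.
(* With the other factors frozen in [W], it is enough to test [h j] on indicators, where the
   induction hypothesis applies. *)
have step : (\int[P]_w (W w * h j (xi j w))%:E = \int[P]_w (K * h j (xi j w))%:E)%E.
  apply: eq_weighted_law => //; try exact: measurable_cst.
  move=> B mB; pose h' m := if m == j then \1_B else h m.
  have h'j : h' j = \1_B by rewrite /h' eqxx.
  have h'i (m : 'I_n) : m != J -> h' m = h m.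
    by move=> mJ; rewrite /h'; case: eqVneq => // mj; case/eqP: mJ; exact/val_inj.
  have mI : measurable_fun setT (fun w => \1_B (xi j w) : R).
    by apply: measurableT_comp => //; exact: measurable_indic.
  transitivity (\int[P]_w (\prod_(m < n) h' m (xi m w))%:E)%E.
    apply: eq_integral => w _; rewrite (bigD1 J)//= h'j mulrC; congr (_ * _)%:E.
    by apply: eq_bigr => m mJ; rewrite h'i.
  rewrite IH.
  - rewrite (bigD1 J)//= h'j.
    under eq_bigr => m mJ do rewrite h'i//.
    rewrite KE muleC; under [RHS]eq_integral do rewrite EFinM.
    rewrite ge0_integralZl_EFin//.
    by apply/measurable_EFinP.
  - by move=> m; rewrite /h'; case: ifP => // _; exact: measurable_indic.
  - by move=> m x; rewrite /h'; case: ifP.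
  - by move=> m; rewrite /h'; case: ifP => // _; exact: I_fin.
  - move=> m jm; rewrite /h'; case: eqVneq => [_|mj]; first by exists B.
    by apply: hA; rewrite ltn_neqAle eq_sym mj.
under eq_integral do rewrite (bigD1 J)//= mulrC.
rewrite step (bigD1 J)//= KE muleC.
under [LHS]eq_integral do rewrite EFinM.
rewrite ge0_integralZl_EFin//.
- by move=> w _; rewrite lee_fin.
- by apply/measurable_EFinP; exact: measurableT_comp.
Qed.
End IndependentProduct.

(** * Moment generating functions *)

Section MomentGenerating.
Context {R : realType} d (Omega : measurableType d) (P : probability Omega R).
Variable X : Omega -> R.
Hypothesis mX : measurable_fun setT X.
Hypothesis finite_mgf : forall t : R, (\int[P]_w (expR (t * X w))%:E < +oo)%E.

Let M (t : R) := \int[P]_w expR (t * X w).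
Let mean := \int[P]_w X w.

Lemma measurable_expRM t : measurable_fun setT (fun w => expR (t * X w)).
Proof. by apply: measurableT_comp => //; exact: measurable_funM. Qed.

Lemma integrable_expRM t : P.-integrable setT (EFin \o (fun w => expR (t * X w))).
Proof.
apply/integrableP; split; first exact/measurable_EFinP/measurable_expRM.
under eq_integral do rewrite gee0_abs ?lee_fin ?expR_ge0//.
exact: finite_mgf.
Qed.

Lemma normr_le_expR (x : R) : `|x| <= expR x + expR (- x).
Proof.
have h1 := expR_ge1Dx x; have h2 := expR_ge1Dx (- x).
have h3 := expR_ge0 x; have h4 := expR_ge0 (- x).
rewrite ler_norml; lra.
Qed.

Lemma integrable_of_mgf : P.-integrable setT (EFin \o X).
Proof.
apply: (@le_integrable _ _ _ P setT measurableT _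
  (EFin \o (fun w => expR (1 * X w) + expR (-1 * X w)))).
- exact/measurable_EFinP.
- move=> w _ /=; rewrite lee_fin mul1r mulN1r.
  by rewrite (le_trans (normr_le_expR _))// ler_norm.
- under [X in _.-integrable _ X]eq_fun do rewrite /= EFinD.
  exact: (integrableD measurableT (integrable_expRM _) (integrable_expRM _)).
Qed.

Lemma integrable_aff (a b : R) : P.-integrable setT (EFin \o (fun w => a + b * X w)).
Proof.
under [X in _.-integrable _ X]eq_fun do rewrite /= EFinD EFinM.
apply: integrableD => //; first exact: finite_measure_integrable_cst.
exact/integrableZl/integrable_of_mgf.
Qed.

Lemma Rintegral_aff (a b : R) : \int[P]_w (a + b * X w) = a + b * mean.
Proof.
rewrite RintegralD//; last 2 first.
- exact: finite_measure_integrable_cst.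
- by under [X in _.-integrable _ X]eq_fun do rewrite /= EFinM; exact/integrableZl/integrable_of_mgf.
rewrite RintegralZl//; last exact: integrable_of_mgf.
by rewrite Rintegral_cst//= probability_setT/= mulr1.
Qed.

Lemma mgf0 : M 0 = 1.
Proof.
rewrite /M; under eq_Rintegral do rewrite mul0r expR0.
by rewrite Rintegral_cst//= probability_setT mulr1.
Qed.

(** The exponential lies above its tangent at [a]. Taking [a = 0] gives a linear lower bound, and
    [a = t * mean] gives Jensen's inequality and positivity. *)
Lemma mgf_ge_affine a t : expR a * (1 + (t * mean - a)) <= M t.
Proof.
have -> : expR a * (1 + (t * mean - a)) =
    \int[P]_w (expR a * (1 - a) + (expR a * t) * X w).
  by rewrite Rintegral_aff; ring.
apply: le_Rintegral => //; [exact: integrable_aff|exact: integrable_expRM|].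
move=> w _; rewrite -[t * X w](subrKC a) expRD -mulrA -mulrDr ler_wpM2l ?expR_ge0//.
by rewrite (le_trans _ (expR_ge1Dx _))//; lra.
Qed.

Lemma mgf_ge1 t : 1 + t * mean <= M t.
Proof. by have := mgf_ge_affine 0 t; rewrite expR0 mul1r subr0. Qed.

Lemma mgf_gt0 t : 0 < M t.
Proof.
have := mgf_ge_affine (t * mean) t; rewrite subrr addr0 mulr1.
exact/lt_le_trans/expR_gt0.
Qed.

Lemma mgf_convex (a b l : R) : 0 <= l <= 1 ->
  M (l * a + (1 - l) * b) <= l * M a + (1 - l) * M b.
Proof.
move=> /andP[l0 l1]; rewrite /M -!RintegralZl//; try exact: integrable_expRM.
have iZ k t : P.-integrable setT (EFin \o (fun w => k * expR (t * X w))).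
  under [X in _.-integrable _ X]eq_fun do rewrite /= EFinM.
  exact/integrableZl/integrable_expRM.
rewrite -RintegralD//; apply: le_Rintegral => //; first exact: integrable_expRM.
  under [X in _.-integrable _ X]eq_fun do rewrite /= EFinD.
  exact: (integrableD measurableT (iZ _ _) (iZ _ _)).
move=> w _; have := convex_expR (Itv01 l0 l1) (a * X w) (b * X w).
rewrite !convRE/= -[unstable.onem l]/(1 - l) (_ : _ * _ + _ * _ = (l * a + (1 - l) * b) * X w)//.
ring.
Qed.

Lemma is_derive_mgf (a : R) : is_derive a 1 M (\int[P]_w (X w * expR (a * X w))).
Proof.
(* Domination on []a - 1, a + 1[]: the first factor bounds the absolute value of [X w], the second
   bounds [expR (x * X w)] by its values at both ends. Expanded as [G'], the product is a sum of
   exponentials, hence integrable. *)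
pose G w := (expR (1 * X w) + expR (-1 * X w)) *
  (expR ((a - 1) * X w) + expR ((a + 1) * X w)).
pose G' w := (expR (a * X w) + expR ((a - 2) * X w)) +
  (expR ((a + 2) * X w) + expR (a * X w)).
have GG' : G = G'.
  apply/funext => w; rewrite /G /G' mulrDl !mulrDr -!expRD addrA [in RHS]addrA.
  rewrite -!mulrDl.
  have -> : 1 + (a - 1) = a by ring.
  have -> : 1 + (a + 1) = a + 2 by ring.
  have -> : -1 + (a - 1) = a - 2 by ring.
  have -> : -1 + (a + 1) = a by ring.
  ring.
have intG : P.-integrable setT (EFin \o G).
  rewrite GG'; under [X in _.-integrable _ X]eq_fun do rewrite /= 2!EFinD.
  apply: integrableD => //.
    exact: (integrableD measurableT (integrable_expRM _) (integrable_expRM _)).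
  exact: (integrableD measurableT (integrable_expRM _) (integrable_expRM _)).
have G0 w : 0 <= G w by rewrite mulr_ge0// addr_ge0// expR_ge0.
have df (x : R) w : is_derive x 1 (fun t : R => expR (t * X w)) (X w * expR (x * X w)).
  have h : is_derive x 1 (fun t : R => t * X w) (X w).
    have := is_deriveM (is_derive_id x 1) (is_derive_cst (X w) x 1).
    by rewrite scaler0 add0r /GRing.scale/= mulr1.
  rewrite [X w * _]mulrC.
  exact: (@is_derive1_comp R expR (fun t : R => t * X w) x _ _ (is_derive_expR (x * X w)) h).
have d1E x w : derive1 (fun t => expR (t * X w)) x = X w * expR (x * X w).
  by rewrite derive1E; have [_ ->] := df x w.
have Ia : a \in `]a - 1, a + 1[ by rewrite in_itv/= ltrDl ltrBlDr ltrDl ltr01.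
have cv := @cvg_differentiation_under_integral R _ _ P
  (fun t w => expR (t * X w)) setT measurableT a (a - 1) (a + 1) Ia
  (fun x _ => integrable_expRM x) _ G G0 intG.
have {cv} := cv _ _.
have H1 : forall (x : R) (w : Omega), (`]a - 1, a + 1[)%classic x ->
    setT w -> derivable (fun t : R => expR (t * X w)) x 1.
  by move=> x w _ _; have [] := df x w.
move=> /(_ H1) cv.
have {}cv := cv _.
have H2 : forall (x : R) (w : Omega), (`]a - 1, a + 1[)%classic x ->
    setT w -> `|derive1 (fun t : R => expR (t * X w)) x| <= G w.
  move=> x w /=; rewrite in_itv/= => /andP[ax xa] _; rewrite d1E normrM.
  rewrite ler_pM// ?mul1r ?mulN1r ?normr_le_expR// ger0_norm ?expR_ge0//.
  have [w0|w0] := leP 0 (X w).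
    by rewrite (@le_trans _ _ (expR ((a + 1) * X w)))// ?lerDr ?expR_ge0// ler_expR ler_wpM2r// ltW.
  by rewrite (@le_trans _ _ (expR ((a - 1) * X w)))// ?lerDl ?expR_ge0// ler_expR ler_wnM2r// ltW.
move: cv => /(_ H2).
rewrite [X in _ --> X](_ : _ = \int[P]_w (X w * expR (a * X w))); last first.
  by apply: eq_Rintegral => w _; rewrite -d1E.
move=> cv.
have cv' : h^-1 *: (M (h *: 1 + a) - M a) @[h --> 0^'] -->
    \int[P]_w (X w * expR (a * X w)).
  by under eq_fun do rewrite scaler1; exact: cv.
by apply: DeriveDef; [apply/cvg_ex; eexists; exact: cv'|exact: cvg_lim cv'].
Qed.

Lemma continuous_mgf : continuous M.
Proof.
move=> a; apply: differentiable_continuous; apply/derivable1_diffP.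
by have [] := is_derive_mgf a.
Qed.

Lemma is_derive_mgf0 : is_derive (0 : R) (1 : R) M mean.
Proof.
have := is_derive_mgf (0 : R).
by under eq_Rintegral do rewrite mul0r expR0 mulr1.
Qed.

(** From [expR u >= u] at [u = t * X w] where [X w] is negative. This linear growth on the left
    brings [M] back to 1 and produces the negative root. *)
Lemma mgf_ge_neg t : t <= 0 -> - t * \int[P]_w Num.max (- X w) 0 <= M t.
Proof.
move=> t0; have mm : measurable_fun setT (fun w => Num.max (- X w) 0).
  by apply: measurable_maxr => //; exact: measurableT_comp.
have im : P.-integrable setT (EFin \o (fun w => Num.max (- X w) 0)).
  apply: le_integrable integrable_of_mgf => //; first exact/measurable_EFinP.
  move=> w _ /=; rewrite lee_fin ger0_norm ?le_max ?lexx ?orbT//.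
  by rewrite ge_max normr_ge0 andbT -normrN ler_norm.
rewrite -RintegralZl//; apply: le_Rintegral => //.
- under [X in _.-integrable _ X]eq_fun do rewrite /= EFinM.
  exact: integrableZl.
- exact: integrable_expRM.
move=> w _; have [w0|w0] := leP (- X w) 0; first by rewrite mulr0 expR_ge0.
by rewrite mulrNN (le_trans _ (expR_ge1Dx _))// lerDr.
Qed.

End MomentGenerating.

(* [d] is the mean; the last four fields locate the sign changes of the
   cumulant generating function. *)
Record cumulant_like {R : realType} (Lam : R -> R) (d ts : R) : Prop := CumulantLike {
  cml_cont : continuous Lam ;
  cml0 : Lam 0 = 0 ;
  cml_derive : is_derive (0 : R) (1 : R) Lam d ;
  cml_d : 0 < d ;
  cml_ts : ts < 0 ;
  cml_root : Lam ts = 0 ;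
  cml_mid : forall t, ts < t -> t < 0 -> Lam t < 0 ;
  cml_left : forall t, t < ts -> 0 < Lam t ;
  cml_right : forall t, 0 < t -> 0 < Lam t }.

(** * Sign changes of the cumulant generating function *)

Section Root.
Context {R : realType}.
Variables (M : R -> R) (d q : R).
Hypotheses (cM : continuous M) (M0 : M 0 = 1) (dM : is_derive (0 : R) (1 : R) M d).
Hypotheses (d0 : 0 < d) (q0 : 0 < q) (Mpos : forall t, 0 < M t).
Hypothesis Mge1 : forall t, 1 + t * d <= M t.
Hypothesis Mge : forall t, t <= 0 -> - t * q <= M t.
Hypothesis Mconv : forall a b l : R, 0 <= l <= 1 ->
  M (l * a + (1 - l) * b) <= l * M a + (1 - l) * M b.

Lemma between_convex (a b c : R) : a < b -> b < c ->
  exists2 l : R, 0 < l < 1 & b = l * a + (1 - l) * c.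
Proof.
move=> ab bc; exists ((c - b) / (c - a)).
  rewrite divr_gt0 ?subr_gt0 ?(lt_trans ab)//=.
  by rewrite ltr_pdivrMr ?subr_gt0 ?(lt_trans ab)// mul1r ltrD2l ltrN2.
field; rewrite subr_eq0 gt_eqF//; exact: lt_trans bc.
Qed.

Lemma mgf_lt1_near0 (s : R) : s < 0 -> exists2 t, s < t < 0 & M t < 1.
Proof.
move=> s0.
have [dv Ed] := dM.
have : h^-1 *: (M (h *: 1 + 0) - M 0) @[h --> 0^'] --> d.
  by rewrite -Ed; exact: dv.
move=> /cvgrPdist_lt/(_ d d0) [r /= r0 hr].
(* Within distance [r] of 0 the difference quotient is closer than [d] to [d], hence positive;
   halving keeps [t] strictly inside both bounds. *)
pose t := - Num.min (r / 2) (- s / 2).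
have m0 : 0 < Num.min (r / 2) (- s / 2) by rewrite lt_min !divr_gt0 ?oppr_gt0.
have t0 : t < 0 by rewrite oppr_lt0.
exists t.
  rewrite t0 andbT /t ltrNr gt_min orbC ltr_pdivrMr// mulr2n mulrDr mulr1.
  by rewrite ltrDl oppr_gt0 s0.
have := hr t; rewrite /= sub0r normrN ltr0_norm// /t opprK.
rewrite gt_min ltr_pdivrMr// ltr_pMr// ltr1n => /(_ isT).
rewrite oppr_eq0 gt_eqF// -/t => /(_ isT).
rewrite -/t scaler1 addr0 M0 /GRing.scale/= => h.
have : 0 < t^-1 * (M t - 1) by move: h; rewrite ltr_norml; lra.
by rewrite nmulr_rgt0 ?invr_lt0// subr_lt0.
Qed.

(** The convexity hypothesis is not strict. Strictness comes from a point [u] close to 0 with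
    [M u < 1]: between [ts] and [u] the chord lies below 1, and to the left of [ts] a value at most
    1 would force [M ts < 1]. *)
Lemma cumulant_like_ln : exists ts, cumulant_like (fun t => ln (M t)) d ts.
Proof.
have [s /andP[_ s0] Ms] := mgf_lt1_near0 (ltrN10 R).
(* At [- q^-1] and to its left the lower bound [Mge] is at least 1. *)
pose b := Num.min s (- q^-1).
have b0 : b < 0 by rewrite gt_min s0.
have Mb : 1 <= M b.
  apply: le_trans (Mge (ltW b0)); rewrite -ler_pdivrMr// mul1r lerNr.
  by rewrite ge_min lexx orbT.
have bs : b <= s by rewrite ge_min lexx.
have [|ts] := @IVT R M b s 1 bs (continuous_subspaceT cM).
  by rewrite ge_min (ltW Ms) orbT le_max Mb.
rewrite in_itv/= => /andP[bts tss] Mts.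
have ts0 : ts < 0 by exact: le_lt_trans s0.
have mid t : ts < t -> t < 0 -> M t < 1.
  move=> tst t0; have [u /andP[tu u0] Mu] := mgf_lt1_near0 t0.
  have [l /andP[l0 l1] ->] := between_convex tst tu.
  have hl : 0 <= l <= 1 by rewrite (ltW l0) (ltW l1).
  have := Mconv ts u hl; rewrite Mts; nra.
have left t : t < ts -> 1 < M t.
  move=> tts; have [u /andP[tu u0] Mu] := mgf_lt1_near0 ts0.
  have [l /andP[l0 l1] El] := between_convex tts tu.
  have hl : 0 <= l <= 1 by rewrite (ltW l0) (ltW l1).
  have := Mconv t u hl; rewrite -El Mts; nra.
exists ts; split => //.
- by move=> t; apply: continuous_comp; [exact: cM|exact: continuous_ln].
- by rewrite M0 ln1.
- have h : is_derive (M 0) (1 : R) (@ln R) (M 0)^-1 by apply: is_derive1_ln.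
  have := is_derive1_comp h dM.
  by rewrite M0 invr1 mul1r.
- by rewrite Mts ln1.
- by move=> t h1 h2; rewrite ln_lt0// Mpos mid.
- by move=> t h1; rewrite ln_gt0// left.
- move=> t t0; rewrite ln_gt0// (lt_le_trans _ (Mge1 t))// ltrDl mulr_gt0//.
Qed.

End Root.

(** * Integrals from the origin and geometric Riemann sums *)

Section Integral0.
Context {R : realType}.
Notation mu := (@lebesgue_measure R).

Lemma integrable_segment (g : R -> R) (a b : R) : continuous g ->
  mu.-integrable `[a, b] (EFin \o g).
Proof.
move=> cg; apply: continuous_compact_integrable; first exact: segment_compact.
exact: continuous_subspaceT.
Qed.

(** The definition splits at the sign of [t]. A base point to the left of both 0 and [t] gives one
    formula, which can be differentiated across 0. *)
Lemma integral0_shift (g : R -> R) (a t : R) : continuous g -> a < 0 -> a < t ->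
  Defs.integral0 g t = \int[mu]_(x in `[a, t]) g x - \int[mu]_(x in `[a, 0]) g x.
Proof.
move=> cg a0 at_; rewrite /Defs.integral0; case: ifPn => [t0|].
  rewrite Rintegral_itvB ?bnd_simp//; [|exact: integrable_segment|exact: ltW].
  rewrite -Rintegral_itv_obnd_cbnd//.
  by apply: integrableS (integrable_segment 0 t cg) => //; apply: subset_itvr; rewrite bnd_simp.
rewrite -ltNge => t0; rewrite -[RHS]opprB Rintegral_itvB ?bnd_simp//;
  [|exact: integrable_segment|exact: ltW|exact: ltW].
rewrite -Rintegral_itv_obnd_cbnd//.
by apply: integrableS (integrable_segment t 0 cg) => //; apply: subset_itvr; rewrite bnd_simp.
Qed.

Lemma is_derive_integral0 (g : R -> R) (t : R) : continuous g ->
  is_derive t 1 (Defs.integral0 g) (g t).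
Proof.
move=> cg; pose a := - (`|t| + 1).
have at_ : a < t by rewrite /a ltrNl (le_lt_trans (ler_norm _))// normrN ltrDl.
have a0 : a < 0 by rewrite oppr_lt0 ltr_wpDl.
have tt : t < t + 1 by rewrite ltrDl.
have [dF F'] := @continuous_FTC1_closed R g a t (t + 1) tt
  (integrable_segment a (t + 1) cg) at_ (cg t).
pose F x := \int[mu]_(y in `[a, x]) g y.
have dFt : is_derive t 1 F (g t).
  by apply: DeriveDef; [exact: dF|rewrite -derive1E; exact: F'].
have dFc : is_derive t 1 (F - cst (F 0)) (g t).
  by rewrite -[g t]subr0; exact: (is_deriveB dFt (is_derive_cst (F 0) t 1)).
apply: near_eq_is_derive dFc; near=> x.
rewrite (integral0_shift (a := a))//.
by near: x; exact: lt_nbhsr.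
Unshelve. all: by end_near. Qed.

Lemma integral00 (g : R -> R) : Defs.integral0 g 0 = 0.
Proof. by rewrite /Defs.integral0 lexx set_itv1 Rintegral_set1. Qed.

Lemma continuous_integral0 (g : R -> R) : continuous g -> continuous (Defs.integral0 g).
Proof.
move=> cg t; apply: differentiable_continuous.
by apply/derivable1_diffP; have [] := is_derive_integral0 t cg.
Qed.

Lemma integral0_unique (g F : R -> R) (t : R) : continuous g ->
  (forall x : R, is_derive x 1 F (g x)) -> F 0 = 0 -> Defs.integral0 g t = F t.
Proof.
move=> cg dF F0; apply/eqP; rewrite -subr_eq0; apply/eqP.
have := @is_derive_0_is_cst R (Defs.integral0 g - F) t 0.
rewrite /= !fctE integral00 F0 subr0; apply => x.
rewrite -(subrr (g x)); apply: is_deriveB.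
exact: is_derive_integral0.
Qed.

Lemma compact_unif_near (g : R -> R) (K : set R) (e : R) : continuous g ->
  compact K -> 0 < e ->
  \forall d \near 0^'+, forall x, K x -> forall y, `|x - y| <= d -> `|g x - g y| <= e.
Proof.
move=> cg /compact_near_coveringP cK e0.
suff: \forall d \near 0^'+, K `<=` (fun x => forall y, `|x - y| <= d -> `|g x - g y| <= e).
  by apply: filterS => d dK x Kx; exact: dK.
apply: cK => x Kx.
have /cvgrPdist_lt/(_ (e / 2)) := cg x; rewrite divr_gt0// => /(_ isT).
case/nbhs_ballP => r /= r0 gr.
exists (ball x (r / 2), [set d | d < r / 2]) => /=.
  split; first exact/nbhsx_ballx/divr_gt0.
  by apply: nbhs_right_lt; rewrite divr_gt0.
move=> [z d]/= [xz dr] y zy.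
have xy : ball x r y.
  rewrite (splitr r); apply: (ball_triangle xz).
  by rewrite /ball/= (le_lt_trans zy).
have xz' : ball x r z.
  by apply: le_ball xz; rewrite ler_pdivrMr// mulr2n mulrDr mulr1 lerDl ltW.
have := gr _ xy; have := gr _ xz' => /= h1 h2.
rewrite (splitr e) -(subrKA (g x)) (le_trans (ler_normD _ _))// lerD//; last exact: ltW.
by rewrite distrC ltW.
Qed.

Lemma integral0_mvt (g : R -> R) (a b : R) : continuous g ->
  exists2 z, `|a - z| <= `|a - b| &
    Defs.integral0 g a - Defs.integral0 g b = g z * (a - b).
Proof.
move=> cg.
have cG u v : {within `[u, v], continuous (Defs.integral0 g)}.
  exact/continuous_subspaceT/continuous_integral0.
have dG u v (x : R) : x \in `]u, v[ -> is_derive x 1 (Defs.integral0 g) (g x).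
  by move=> _; exact: is_derive_integral0.
have [ab|/ltW ba] := leP a b.
  have [z] := MVT_segment ab (@dG a b) (cG _ _).
  rewrite in_itv/= => /andP[az zb] E; exists z.
    rewrite distrC ger0_norm ?subr_ge0// distrC ger0_norm ?subr_ge0//.
    by rewrite lerB.
  by rewrite -[LHS]opprB E -mulrN opprB.
have [z] := MVT_segment ba (@dG b a) (cG _ _).
rewrite in_itv/= => /andP[bz za] E; exists z => //.
by rewrite ger0_norm ?subr_ge0// ger0_norm ?subr_ge0// lerB.
Qed.

End Integral0.

Section GeometricRiemannSum.
Context {R : realType}.
Implicit Types (g : R -> R) (t c : R).

(* The points [t * c ^+ m] cut the segment between [0] and [t]; the summands
   are the left values of [g] times the lengths of the pieces. *)
Lemma geometric_riemann_sum g t e : continuous g -> 0 < e ->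
  \forall d \near 0^'+, forall n,
  `| d * \sum_(m < n) (t * (1 - d) ^+ m * g (t * (1 - d) ^+ m))
     - (Defs.integral0 g t - Defs.integral0 g (t * (1 - d) ^+ n)) | <= e.
Proof.
move=> cg e0.
have K : compact `[- `|t|, `|t|]%classic by exact: segment_compact.
(* The pieces have total length at most the absolute value of [t]; the added 1 covers [t = 0]. *)
pose e' := e / (`|t| + 1).
have t1 : 0 < `|t| + 1 by rewrite ltr_wpDl.
have e'0 : 0 < e' by rewrite divr_gt0.
have [r /= r0 hr] := compact_unif_near cg K e'0.
near=> d => n.
have d0 : 0 < d by near: d; exact: nbhs_right_gt.
have d1 : d < 1 by near: d; exact: nbhs_right_lt.
have hd x : `|x| <= `|t| -> forall y, `|x - y| <= `|t| * d -> `|g x - g y| <= e'.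
  move=> xt y xy; apply: (hr (r / 2)) => //.
  - by rewrite /ball/= sub0r normrN gtr0_norm ?divr_gt0// ltr_pdivrMr// ltr_pMr// ltr1n.
  - by rewrite divr_gt0.
  - by rewrite /= in_itv/= -ler_norml.
  - apply: (le_trans xy); apply: (@le_trans _ _ ((`|t| + 1) * d)).
      by rewrite ler_wpM2r ?lerDl ?ltW.
    by rewrite mulrC -ler_pdivlMr//; near: d; apply: nbhs_right_le; rewrite !divr_gt0.
pose c := 1 - d; pose u m := t * c ^+ m; pose G := Defs.integral0 g.
have c0 : 0 <= c by rewrite subr_ge0 ltW.
have c1 : c <= 1 by rewrite gerBl ltW.
have ut m : `|u m| <= `|t|.
  by rewrite normrM normrX (ger0_norm c0) ler_piMr// exprn_ile1.
have uB m : u m - u m.+1 = d * u m by rewrite /u exprSr /c; ring.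
have step m : `|d * (u m * g (u m)) - (G (u m) - G (u m.+1))| <= e' * `|u m - u m.+1|.
  have [z uz ->] := integral0_mvt (u m) (u m.+1) cg.
  rewrite uB (_ : _ - _ = (g (u m) - g z) * (d * u m)); last by ring.
  rewrite normrM ler_wpM2r// hd// (le_trans uz)// uB normrM (gtr0_norm d0) mulrC.
  by rewrite ler_wpM2r// ltW.
have uB' m : `|u m - u m.+1| = `|t| * (c ^+ m - c ^+ m.+1).
  rewrite /u -mulrBr normrM [X in _ * X]ger0_norm// subr_ge0 exprS ler_piMl//.
  exact: exprn_ge0.
(* The errors add up to [e'] times the length covered so far, a bound uniform in [n]. *)
suff : `|d * (\sum_(m < n) u m * g (u m)) - (G t - G (u n))| <= e' * (`|t| * (1 - c ^+ n)).
  move=> /le_trans; apply.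
  rewrite /e' -mulrA ler_piMr ?(ltW e0)// mulrC ler_pdivrMr// mul1r.
  rewrite (@le_trans _ _ `|t|) ?lerDl// ler_piMr// gerBl exprn_ge0//.
elim: n => [|n IH].
  by rewrite big_ord0 mulr0 /u expr0 mulr1 !subrr normr0 !mulr0.
rewrite big_ord_recr/= mulrDr.
rewrite (_ : _ - _ = (d * (\sum_(m < n) u m * g (u m)) - (G t - G (u n))) +
  (d * (u n * g (u n)) - (G (u n) - G (u n.+1)))); last by ring.
rewrite (le_trans (ler_normD _ _))//.
rewrite (_ : 1 - c ^+ n.+1 = (1 - c ^+ n) + (c ^+ n - c ^+ n.+1)); last by ring.
by rewrite mulrDr mulrDr lerD// (le_trans (step _))// uB'.
Unshelve. all: by end_near. Qed.
End GeometricRiemannSum.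

(** * The rate function and its unique minimizer *)

Section Slope.
Context {R : realType}.
Variables (Lam : R -> R) (d ts : R).
Hypothesis HL : cumulant_like Lam d ts.

(** The integrand of the rate, with its value at 0 supplied by hand. As the derivative of [rate], it
    is also the limiting tilted mean of the rescaled discounted sum, and so the centre of the window
    in the lower bound. *)
Definition slope (L : R -> R) (v : R) (x : R) : R := if x == 0 then v else L x / x.

Lemma slope_cvg0 : Lam x / x @[x --> 0^'] --> d.
Proof.
have [dv Ed] := cml_derive HL.
have : h^-1 *: (Lam (h *: 1 + 0) - Lam 0) @[h --> 0^'] --> d.
  by rewrite -Ed; exact: dv.
apply: cvg_trans; apply: near_eq_cvg; near=> h.
by rewrite scaler1 addr0 (cml0 HL) subr0 mulrC.
Unshelve. all: by end_near. Qed.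

Lemma continuous_slope : continuous (slope Lam d).
Proof.
move=> x; have [->|x0] := eqVneq x 0.
  apply/continuous_withinNx; rewrite {2}/slope eqxx.
  apply: cvg_trans slope_cvg0; apply: near_eq_cvg; near=> h.
  rewrite /slope ifF//; apply/negbTE; near: h; exact: nbhs_dnbhs_neq.
have : {for x, continuous (fun y => Lam y / y)}.
  by apply: cvgM; [exact: (cml_cont HL)|exact: cvgV].
have E : slope Lam d x = Lam x / x by rewrite /slope (negbTE x0).
rewrite /prop_for /continuous_at E; apply: cvg_trans.
apply: near_eq_cvg; near=> h; rewrite /slope ifF//; apply/negbTE.
near: h; exact: (cvgr_neq0 _ _ x0).
Unshelve. all: by end_near. Qed.

Lemma slopeM x : x * slope Lam d x = Lam x.
Proof.
rewrite /slope; have [->|x0] := eqVneq x 0; first by rewrite mul0r (cml0 HL).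
by rewrite mulrC divfK.
Qed.

Lemma slope_lt0 x : x < ts -> slope Lam d x < 0.
Proof.
move=> xt; have x0 : x < 0 := lt_trans xt (cml_ts HL).
by rewrite /slope lt_eqF// nmulr_llt0 ?invr_lt0// (cml_left HL).
Qed.

Lemma slope_gt0 x : ts < x -> 0 < slope Lam d x.
Proof.
move=> xt; rewrite /slope; have [x0|x0|x0] := ltgtP x 0.
- by rewrite nmulr_lgt0 ?invr_lt0// (cml_mid HL).
- by rewrite divr_gt0// (cml_right HL).
- exact: (cml_d HL).
Qed.

Definition rate t := Defs.integral0 (slope Lam d) t.

Lemma rate_mvt (a b : R) : a < b ->
  exists2 z, a < z < b & rate b - rate a = slope Lam d z * (b - a).
Proof.
move=> ab; have [z] := @MVT R rate (slope Lam d) a b ab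
  (fun x _ => is_derive_integral0 x continuous_slope)
  (continuous_subspaceT (continuous_integral0 continuous_slope)).
by rewrite in_itv/= => zab E; exists z.
Qed.

Lemma rate_decr a b : a < b -> b <= ts -> rate b < rate a.
Proof.
move=> ab bt; have [z /andP[az zb] E] := rate_mvt ab.
by rewrite -subr_lt0 E nmulr_rlt0 ?subr_gt0// slope_lt0// (lt_le_trans zb).
Qed.

Lemma rate_incr a b : a < b -> ts <= a -> rate a < rate b.
Proof.
move=> ab bt; have [z /andP[az zb] E] := rate_mvt ab.
by rewrite -subr_gt0 E mulr_gt0 ?subr_gt0// slope_gt0// (le_lt_trans bt).
Qed.

Lemma rate_min t : rate ts <= rate t ?= iff (t == ts).
Proof.
have [tt|tt|->] := ltgtP t ts; last exact/leifP.
- by apply/leifP; rewrite rate_decr.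
- by apply/leifP; rewrite rate_incr.
Qed.

Lemma rate0 : rate 0 = 0. Proof. exact: integral00. Qed.

Lemma continuous_rate : continuous rate.
Proof. exact/continuous_integral0/continuous_slope. Qed.

Lemma cml_ts_unique t : t != 0 -> Lam t = 0 -> t = ts.
Proof.
move=> t0 Lt; have [tt|tt|//] := ltgtP t ts.
  by have := cml_left HL tt; rewrite Lt ltxx.
have [t00|t00|t00] := ltgtP t 0; last by rewrite t00 eqxx in t0.
  by have := cml_mid HL tt t00; rewrite Lt ltxx.
by have := cml_right HL t00; rewrite Lt ltxx.
Qed.

(* The discounted sums of the cumulant generating function are the exponents of
   the partial sums of the signals. *)
Lemma discounted_cumulant_cvg (t e : R) : 0 < e ->
  \forall dl \near 0^'+, \forall n \near \oo,
  `|dl * \sum_(m < n) Lam (t * (1 - dl) ^+ m) - rate t| <= e.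
Proof.
move=> e0; have e2 : 0 < e / 2 by rewrite divr_gt0.
have key := geometric_riemann_sum t continuous_slope e2.
near=> dl.
have kd : forall n, `|dl * \sum_(m < n) (t * (1 - dl) ^+ m * slope Lam d (t * (1 - dl) ^+ m)) -
    (rate t - rate (t * (1 - dl) ^+ n))| <= e / 2 by near: dl; exact: key.
have d0 : 0 < dl by near: dl; exact: nbhs_right_gt.
have d1 : dl < 1 by near: dl; exact: nbhs_right_lt.
(* The first [n] points leave the piece between 0 and [t * (1 - dl) ^+ n] uncovered; its
   contribution vanishes as [n] grows. *)
have cv : rate (t * (1 - dl) ^+ n) @[n --> \oo] --> 0.
  rewrite -rate0; apply: continuous_cvg; first exact: continuous_rate.
  rewrite -(mulr0 t); apply: cvgM; first exact: cvg_cst.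
  by apply: cvg_expr; rewrite ltr_norml; lra.
near=> n.
have h2 : `|rate (t * (1 - dl) ^+ n)| <= e / 2.
  by rewrite -normrN -sub0r; near: n; move/cvgrPdist_le: cv; apply.
rewrite (eq_bigr (fun m : 'I_n => t * (1 - dl) ^+ m * slope Lam d (t * (1 - dl) ^+ m))); last first.
  by move=> m _; rewrite slopeM.
have := kd n; move: h2; rewrite !ler_norml; lra.
Unshelve. all: by end_near. Qed.

End Slope.

(** * Large deviations of discounted sums *)

Section AlmostSure.
Context {R : realType} d (Omega : measurableType d) (P : probability Omega R).
Local Open Scope ereal_scope.

(** Cauchy's criterion with tolerances [k.+1%:R^-1] describes convergence by countable
    operations. *)
Lemma measurable_set_cvgn (f : nat -> Omega -> R) :
  (forall n, measurable_fun setT (f n)) ->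
  measurable [set w | cvgn (fun n => f n w)].
Proof.
move=> mf; pose A k N n := [set w | (`|f n w - f N w| <= k.+1%:R^-1)%R].
have mA k N n : measurable (A k N n).
  have mg : measurable_fun setT (fun w => `|f n w - f N w|%R).
    by apply: measurableT_comp => //; exact: measurable_funB.
  rewrite (_ : A k N n = (fun w => `|f n w - f N w|%R) @^-1` `]-oo, (k.+1%:R^-1)%R]).
    by rewrite -[X in measurable X]setTI; exact: mg.
  by apply/seteqP; split => w; rewrite /A/= in_itv/=.
rewrite (_ : [set w | _] = \bigcap_k \bigcup_N \bigcap_(n in [set n | (N <= n)%N]) A k N n).
  apply: bigcap_measurable; first by exists 0%N.
  move=> k _; apply: bigcup_measurable => N _.
  by apply: bigcap_measurable; first by exists N => /=.
apply/seteqP; split => w /=.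
  move=> /cvg_cauchy /cauchy_ballP cw k _.
  have k0 : (0 < k.+1%:R^-1 :> R)%R by rewrite invr_gt0.
  have [[U V]/= [[N1 _ hU] [N2 _ hV]] UV] := cw _ k0.
  pose N := maxn N1 N2; exists N => // n /= Nn.
  have := UV (f n w, f N w); rewrite /A/= => h; apply/ltW; apply: h => /=.
  split; [apply: hU|apply: hV] => /=; rewrite ?leq_maxr//.
  by rewrite (leq_trans _ Nn)// leq_maxl.
move=> h; apply/cauchy_cvgP/cauchy_ballP => e e0.
have [k ke] : exists k : nat, (k.+1%:R^-1 < e / 2 :> R)%R.
  have e20 : (0 < e / 2)%R by rewrite divr_gt0.
  have [k _ hk] := near_infty_natSinv_lt (PosNum e20).
  by exists k; apply: hk => /=.
have [N _ hN] := h k Logic.I.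
exists ((fun n => f n w) @` [set n | (N <= n)%N], (fun n => f n w) @` [set n | (N <= n)%N]) => /=.
  by split; exists N => // n Nn; exists n.
move=> [x y]/= [[n Nn <-] [m Nm <-]]; rewrite /ball/=.
have := hN n Nn; have := hN m Nm; rewrite /A/= => h1 h2.
rewrite -(subrKA (f N w)) (le_lt_trans (ler_normD _ _))// (splitr e) ltrD//.
  exact: le_lt_trans h2 ke.
by rewrite distrC; exact: le_lt_trans h1 ke.
Qed.

Lemma measurable_limn_le (f : nat -> Omega -> R) (a : R) :
  (forall n, measurable_fun setT (f n)) ->
  measurable [set w | (limn (fun n => f n w) <= a)%R].
Proof.
move=> mf; pose Cv := [set w | cvgn (fun n => f n w)].
have mC : measurable Cv by exact: measurable_set_cvgn.
pose g w := limn (fun n => f n w).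
have mg : measurable_fun Cv g.
  apply: (@measurable_fun_cvg _ _ _ _ (fun n w => f n w)) => //.
  by move=> n; apply: measurable_funTS.
have mCE : measurable (Cv `&` [set w | (g w <= a)%R]).
  rewrite (_ : [set w | _] = g @^-1` `]-oo, a]); first exact: mg.
  by apply/seteqP; split => w; rewrite /= in_itv/=.
rewrite -[X in measurable X](setUIDK _ Cv).
rewrite setIC; apply: measurableU => //.
(* Off the convergence set [limn] takes the constant value [point], so this part is either the whole
   complement of [Cv] or empty. *)
have [a0|a0] := pselect ((point : R) <= a)%R.
  rewrite (_ : _ `\` _ = ~` Cv); first exact: measurableC.
  apply/seteqP; split => w /=; first by case.
  by move=> nC; split => //; rewrite dvgP.
rewrite (_ : _ `\` _ = set0); first exact: measurable0.
by apply/seteqP; split => w //= [h nC]; apply: a0; rewrite dvgP in h.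
Qed.

(* The expectation of [\sum_m c ^+ m * `|X m|] is finite. *)
Lemma ae_cvg_discounted (X : nat -> Omega -> R) (K c : R) :
  (forall m, measurable_fun setT (X m)) -> (0 < c < 1)%R ->
  (forall m, \int[P]_w (`|X m w|)%:E <= K%:E) ->
  {ae P, forall w, cvgn (series (fun m => c ^+ m * X m w)%R)}.
Proof.
move=> mX /andP[c0 c1] XK.
have K0 : (0 <= K)%R.
  by rewrite -lee_fin (le_trans _ (XK 0%N))// integral_ge0// => w _; rewrite lee_fin.
pose F m w := (c ^+ m * `|X m w|)%R.
have mF m : measurable_fun setT (EFin \o F m).
  apply/measurable_EFinP; apply: measurable_funM => //.
  exact: measurableT_comp.
have F0 m w : (0 <= F m w)%R by rewrite mulr_ge0// exprn_ge0// ltW.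
have msum : measurable_fun setT (fun w => \sum_(m <oo) (F m w)%:E).
  have := @ge0_emeasurable_sum _ _ R setT (fun m w => (F m w)%:E) xpredT.
  by apply => [m w _ _|m _]; [rewrite lee_fin|exact: mF].
have intF : P.-integrable setT (fun w => \sum_(m <oo) (F m w)%:E).
  apply/integrableP; split => //.
  under eq_integral => w _.
    rewrite gee0_abs; last by apply: nneseries_ge0 => m _ _; rewrite lee_fin.
    over.
  rewrite integral_nneseries//; last by move=> m w _; rewrite lee_fin.
  apply: (@le_lt_trans _ _ (\sum_(m <oo) (geometric K c m)%:E)).
    apply: lee_nneseries => [m _ _|m _]; first by apply: integral_ge0 => w _; rewrite lee_fin.
    rewrite /F; under eq_integral do rewrite EFinM.
    rewrite ge0_integralZl_EFin//; last 2 first.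
    - by apply/measurable_EFinP; exact: measurableT_comp.
    - by rewrite exprn_ge0// ltW.
    by rewrite /geometric/= mulrC EFinM lee_pmul2l ?fin_numE// lte_fin exprn_gt0.
  have cvg : (series (geometric K c) @ \oo --> (K * (1 - c)^-1)%R).
    by apply: cvg_geometric_series; rewrite ger0_norm ?ltW.
  rewrite (_ : limn _ = (limn (series (geometric K c)))%:E) ?ltry//.
  rewrite -EFin_lim; last by apply/cvg_ex; eexists; exact: cvg.
  congr (limn _); apply/funext => n; rewrite /series/= -sumEFin.
  by [].
apply: filterS (integrable_ae measurableT intF) => w /(_ Logic.I) fin.
apply: normed_cvg.
apply: nondecreasing_is_cvgn; first by apply: nondecreasing_series => m _ _; exact: normr_ge0.
exists (fine (\sum_(m <oo) (F m w)%:E)) => _ [n _ <-].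
rewrite -lee_fin fineK// /series/= -sumEFin.
rewrite [leLHS](_ : _ = \sum_(0 <= m < n) (F m w)%:E); last first.
  by apply: eq_bigr => m _; rewrite /F normrM ger0_norm// exprn_ge0// ltW.
by apply: nneseries_lim_ge => m _ _; rewrite lee_fin.
Qed.

(* Egorov's theorem compares the event on the limit with events on the terms. *)
Lemma prob_limn_le (f : nat -> Omega -> R) (eta e : R) :
  (forall n, measurable_fun setT (f n)) ->
  {ae P, forall w, cvgn (fun n => f n w)} -> (0 < eta)%R -> (0 < e)%R ->
  \forall n \near \oo,
    P [set w | (limn (fun n => f n w) <= 0)%R] <= P [set w | (f n w <= eta)%R] + e%:E /\
    P [set w | (f n w <= - eta)%R] <= P [set w | (limn (fun n => f n w) <= 0)%R] + e%:E.
Proof.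
move=> mf [D [mD PD0 subD]] eta0 e0.
pose Cv := [set w | cvgn (fun n => f n w)].
have mC : measurable Cv by exact: measurable_set_cvgn.
pose g w := limn (fun n => f n w).
have mg : measurable_fun Cv g.
  apply: (@measurable_fun_cvg _ _ _ _ (fun n w => f n w)) => //.
  by move=> n; apply: measurable_funTS.
have [B [mB PB unif]] := @pointwise_almost_uniform _ R Omega P f g Cv e
  (fun n => measurable_funTS (mf n)) mC
  (le_lt_trans (probability_le1 P mC) (ltry _)) (fun w cw => cw) e0.
have PC0 : P (~` Cv) = 0.
  by apply: (subset_measure0 (measurableC mC) mD _ PD0) => w nC; apply: subD.
have PBC : P (B `|` ~` Cv) <= e%:E.
  by rewrite measureU0//; [exact: ltW|exact: measurableC].
have mE : measurable [set w | (g w <= 0)%R] by exact: measurable_limn_le.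
have mF n a : measurable [set w | (f n w <= a)%R].
  rewrite (_ : [set w | _] = f n @^-1` `]-oo, a]).
    by rewrite -[X in measurable X]setTI; exact: mf.
  by apply/seteqP; split => w; rewrite /= in_itv/=.
have cmp (A1 A2 : set Omega) : measurable A1 -> measurable A2 ->
    A1 `<=` A2 `|` (B `|` ~` Cv) -> P A1 <= P A2 + e%:E.
  move=> m1 m2 sub; have mBC := measurableU _ _ mB (measurableC mC).
  apply: (@le_trans _ _ (P (A2 `|` (B `|` ~` Cv)))).
    by rewrite le_measure// inE//; exact: measurableU.
  apply: (@le_trans _ _ (P A2 + P (B `|` ~` Cv))); last by rewrite leeD2l.
  exact: measureU2.
have : \forall n \near \oo, forall w, (Cv `\` B) w -> (`|g w - f n w| < eta)%R.
  apply: (unif [set h | forall w, (Cv `\` B) w -> (`|g w - h w| < eta)%R]).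
  apply/uniform_nbhs; exists [set xy | ball xy.1 eta xy.2]; split => //.
  exact: (entourage_ball _ (PosNum eta0)).
apply: filterS => n hn; split; apply: cmp => // w /= h.
- have [BC|nBC] := pselect ((B `|` ~` Cv) w); [by right|left => /=].
  have /hn : (Cv `\` B) w.
    by split; [apply: contrapT => nC; apply: nBC; right|move=> Bw; apply: nBC; left].
  by rewrite ltr_norml; move: h; rewrite -/(g w); lra.
- have [BC|nBC] := pselect ((B `|` ~` Cv) w); [by right|left => /=].
  have /hn : (Cv `\` B) w.
    by split; [apply: contrapT => nC; apply: nBC; right|move=> Bw; apply: nBC; left].
  by rewrite ltr_norml -/(g w); lra.
Qed.
End AlmostSure.

(** * Exponential bounds from above and from below *)

Section Chernoff.
Context {R : realType} d (Omega : measurableType d) (P : probability Omega R).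
Variables (Z : Omega -> R) (mg : R -> R).
Hypothesis mZ : measurable_fun setT Z.
Hypothesis hZ : forall t : R, (\int[P]_w (expR (t * Z w))%:E = (mg t)%:E)%E.

Let fin t : (\int[P]_w (expR (t * Z w))%:E < +oo)%E.
Proof. by rewrite hZ ltry. Qed.

Lemma measurable_le_set (b : R) : measurable [set w | Z w <= b].
Proof.
rewrite (_ : [set w | _] = Z @^-1` `]-oo, b]).
  by rewrite -[X in measurable X]setTI; exact: mZ.
by apply/seteqP; split => w; rewrite /= in_itv/=.
Qed.

Let p (b : R) := fine (P [set w | Z w <= b]).

Let pE b : p b = \int[P]_w \1_[set w | Z w <= b] w.
Proof.
by rewrite /p /Rintegral integral_indic ?setIT//; exact: measurable_le_set.
Qed.

Let RhZ t : \int[P]_w expR (t * Z w) = mg t.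
Proof. by rewrite /Rintegral hZ. Qed.

Let intZ k t : P.-integrable setT (EFin \o (fun w => k * expR (t * Z w))).
Proof.
under [X in _.-integrable _ X]eq_fun do rewrite /= EFinM.
apply: integrableZl => //; exact: integrable_expRM.
Qed.

Let RintZ k t : \int[P]_w (k * expR (t * Z w)) = k * mg t.
Proof. by rewrite RintegralZl ?RhZ//; exact: integrable_expRM. Qed.

Let int1 k b : P.-integrable setT (EFin \o (fun w => k * \1_[set w | Z w <= b] w)).
Proof.
under [X in _.-integrable _ X]eq_fun do rewrite /= EFinM.
by apply: integrableZl => //; apply: integrable_indic => //; exact: measurable_le_set.
Qed.

Lemma chernoff_le (t b : R) : t <= 0 -> p b <= expR (- (t * b)) * mg t.
Proof.
move=> t0; rewrite pE -RintZ; apply: le_Rintegral => //.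
  by have := int1 1 b; under [X in _.-integrable _ X]eq_fun do rewrite /= mul1r.
move=> w _; rewrite indicE; case: (boolP (w \in _)) => [|_]; last by rewrite mulr_ge0 ?expR_ge0.
rewrite inE/= => Zb; rewrite -expRD -[leLHS]expR0 ler_expR; nra.
Qed.

(* Outside of the window [a, b] the exponential [expR (t * Z)] is dominated by
   the exponentials with the shifted parameters [t - s] and [t + s]. *)
Lemma chernoff_ge (t s a b : R) : t <= 0 -> 0 <= s ->
  mg t <= expR (t * a) * p b + expR (- (s * b)) * mg (t + s) +
          expR (s * a) * mg (t - s).
Proof.
move=> t0 s0; rewrite pE -!RintZ -RintegralZl//; last first.
  by have := int1 1 b; under [X in _.-integrable _ X]eq_fun do rewrite /= mul1r.
have i2 : P.-integrable setT (EFin \o (fun w => expR (t * a) * \1_[set w | Z w <= b] w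
    + expR (- (s * b)) * expR ((t + s) * Z w))).
  under [X in _.-integrable _ X]eq_fun do rewrite /= EFinD.
  exact: (integrableD measurableT (int1 _ _) (intZ _ _)).
rewrite -RintegralD// -RintegralD//.
rewrite -RhZ; apply: le_Rintegral => //; first exact: integrable_expRM.
  under [X in _.-integrable _ X]eq_fun do rewrite /= EFinD.
  exact: (integrableD measurableT i2 (intZ _ _)).
move=> w _.
have g1 : 0 <= expR (t * a) * \1_[set w | Z w <= b] w by rewrite mulr_ge0// expR_ge0.
have g2 : 0 <= expR (- (s * b)) * expR ((t + s) * Z w) by rewrite mulr_ge0// expR_ge0.
have g3 : 0 <= expR (s * a) * expR ((t - s) * Z w) by rewrite mulr_ge0// expR_ge0.
have [Zb|bZ] := leP (Z w) b; last first.
  suff : expR (t * Z w) <= expR (- (s * b)) * expR ((t + s) * Z w) by lra.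
  rewrite -expRD ler_expR; nra.
have [Za|aZ] := leP (Z w) a.
  suff : expR (t * Z w) <= expR (s * a) * expR ((t - s) * Z w) by lra.
  rewrite -expRD ler_expR; nra.
suff : expR (t * Z w) <= expR (t * a) * \1_[set w | Z w <= b] w by lra.
rewrite indicE mem_set// mulr1 ler_expR; nra.
Qed.

End Chernoff.

(* The arithmetic of the lower bound: [A], [B], [D] are the cumulants of the sum
   at [t], [t + s], [t - s], which [dl] rescales to [ft], [fp], [fm] up to [r]. *)
Lemma exp_window_bound (R : realType)
    (dl t s ep y e r f0 ft fp fm A B D Q : R) :
  0 < dl -> dl <= s * ep / 12 -> dl <= e / 4 -> r <= s * ep / 8 -> r <= e / 4 ->
  t * y - t * ep <= e / 4 / 2 -> f0 <= ft ->
  fp <= ft + s * y + s * ep / 2 -> fm <= ft - s * y + s * ep / 2 ->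
  `|dl * A - ft| <= r -> `|dl * B - fp| <= r -> `|dl * D - fm| <= r ->
  expR A <= expR (t * ((y - ep) / dl)) * Q +
    expR (- (s * ((y + ep) / dl))) * expR B + expR (s * ((y - ep) / dl)) * expR D ->
  expR ((f0 - e) / dl) <= Q.
Proof.
move=> d0 ds de r8 re Lt mn hp hm; rewrite !ler_norml.
move=> /andP[hA _] /andP[_ hB] /andP[_ hD]; rewrite -!expRD.
have dne : dl != 0 by rewrite gt_eqF.
(* Origin of the bounds on [dl]: [c = 4] with [a = s * ep / 4] asks for [dl <= s * ep / 12], and
   [c = 2] with [a = e / 4] asks for [dl <= e / 4]. *)
have expR_small c a : 0 < c -> (c - 1) * dl <= a -> expR (- a / dl) <= 1 / c.
  move=> c0 ca; rewrite mulNr expRN -[leLHS]div1r ler_pdivrMr ?expR_gt0//.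
  rewrite mulrAC ler_pdivlMr// !mul1r (le_trans _ (expR_ge1Dx _))//.
  by rewrite -lerBlDl ler_pdivlMr.
have small : expR (- (s * ep / 4) / dl) <= 1 / 4.
  by apply: expR_small => //; clear -ds; lra.
have half : expR (- (e / 4) / dl) <= 1 / 2.
  by apply: expR_small => //; clear -de; lra.
(* Each term outside the window takes at most a quarter of [expR A]: of the gain [s * ep / 2], two
   errors [r <= s * ep / 8] consume at most half. *)
have {}hB : expR (- (s * ((y + ep) / dl)) + B) <= expR A * (1 / 4).
  apply: le_trans (ler_wpM2l (expR_ge0 _) small); rewrite -expRD ler_expR.
  rewrite -(ler_pM2l d0) !mulrDr.
  rewrite (_ : dl * - (s * ((y + ep) / dl)) = - (s * (y + ep))); last by field.
  rewrite (_ : dl * (- (s * ep / 4) / dl) = - (s * ep / 4)); last by field.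
  by clear -hA hB hp r8; lra.
have {}hD : expR (s * ((y - ep) / dl) + D) <= expR A * (1 / 4).
  apply: le_trans (ler_wpM2l (expR_ge0 _) small); rewrite -expRD ler_expR.
  rewrite -(ler_pM2l d0) !mulrDr.
  rewrite (_ : dl * (s * ((y - ep) / dl)) = s * (y - ep)); last by field.
  rewrite (_ : dl * (- (s * ep / 4) / dl) = - (s * ep / 4)); last by field.
  by clear -hA hD hm r8; lra.
move=> h.
have {h hB hD} h : expR A / 2 <= expR (t * ((y - ep) / dl)) * Q.
  by clear -h hB hD; lra.
have {h} : expR A * expR (- (e / 4) / dl) <= expR (t * ((y - ep) / dl)) * Q.
  by rewrite (le_trans _ h)// ler_wpM2l ?expR_ge0// -[2^-1]div1r.
rewrite -expRD [leRHS]mulrC -ler_pdivrMr ?expR_gt0// -expRN -expRD.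
apply: le_trans; rewrite ler_expR -(ler_pM2l d0) !mulrDr.
rewrite (_ : dl * ((f0 - e) / dl) = f0 - e); last by field.
rewrite (_ : dl * (- (e / 4) / dl) = - (e / 4)); last by field.
rewrite (_ : dl * - (t * ((y - ep) / dl)) = - (t * y - t * ep)); last by field.
by clear -hA mn Lt re d0 de; lra.
Qed.

(** * The exponent of the discounted series *)

Section LargeDeviations.
Context {R : realType} d (Omega : measurableType d) (P : probability Omega R).
Variables (X : nat -> Omega -> R) (Lam : R -> R) (mean ts K : R).
Hypothesis mX : forall m, measurable_fun setT (X m).
Hypothesis HL : cumulant_like Lam mean ts.
Hypothesis Hprod : forall n (a : nat -> R),
  (\int[P]_w (expR (\sum_(m < n) a m * X m w))%:E =
   (expR (\sum_(m < n) Lam (a m)))%:E)%E.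
Hypothesis HK : forall m, (\int[P]_w (`|X m w|)%:E <= K%:E)%E.

Let S (dl : R) n w := series (fun m => (1 - dl) ^+ m * X m w) n.
Let E (dl : R) : set Omega := [set w | limn (fun n => S dl n w) <= 0].
Let psi (dl : R) n (t : R) := \sum_(m < n) Lam (t * (1 - dl) ^+ m).
Let phi := rate Lam mean.

Let mS dl n : measurable_fun setT (S dl n).
Proof.
rewrite /S /series/=; apply: measurable_sum => m.
exact: measurable_funM.
Qed.

Let hS dl n t : (\int[P]_w (expR (t * S dl n w))%:E = (expR (psi dl n t))%:E)%E.
Proof.
rewrite /psi -(Hprod n (fun m => t * (1 - dl) ^+ m)).
apply: eq_integral => w _; rewrite /S /series/= mulr_sumr big_mkord.
by congr (expR _)%:E; apply: eq_bigr => m _; rewrite mulrA.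
Qed.

Let p dl := fine (P (E dl)).
Let q dl n b := fine (P [set w | S dl n w <= b]).

Let compare (dl eta e : R) : 0 < dl < 1 -> 0 < eta -> 0 < e ->
  \forall n \near \oo, p dl <= q dl n eta + e /\ q dl n (- eta) <= p dl + e.
Proof.
move=> /andP[d0 d1] eta0 e0.
have cv : {ae P, forall w, cvgn (fun n => S dl n w)}.
  by apply: (@ae_cvg_discounted _ _ _ P X K (1 - dl)) => //; lra.
have := @prob_limn_le _ _ _ P (S dl) eta e (mS dl) cv eta0 e0.
have mE : measurable (E dl) by apply: measurable_limn_le; exact: mS.
apply: filterS => n [h1 h2].
have mq b : measurable [set w | S dl n w <= b] by apply: measurable_le_set.
by split; rewrite -lee_fin EFinD !fineK ?fin_num_measure.
Qed.

(** To the left of [ts] the slope is negative, so a small window around it lies below 0. The price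
    of leaving [ts] is [Lam t = t * slope Lam mean t], small because [Lam ts = 0]. The step [s]
    makes the first-order expansion of [phi] at [t] accurate to [s * ep / 2]. *)
Lemma exists_expR_window (e : R) : 0 < e -> exists t s ep : R,
  [/\ t < 0, 0 < s, 0 < ep, Lam t - t * ep <= e / 2 &
   [/\ slope Lam mean t + ep < 0,
     phi (t + s) <= phi t + s * slope Lam mean t + s * ep / 2 &
     phi (t - s) <= phi t - s * slope Lam mean t + s * ep / 2]].
Proof.
move=> e0.
have [t tts Lt] : exists2 t, t < ts & Lam t <= e / 4.
  have := @cml_cont _ _ _ _ HL ts; rewrite /continuous_at (cml_root HL).
  move=> /cvgrPdist_le/(_ (e / 4)); rewrite divr_gt0// => /(_ isT)[r /= r0 hr].
  exists (ts - r / 2); first by rewrite gtrBl divr_gt0.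
  have := hr (ts - r / 2); rewrite /= opprB addrC subrK gtr0_norm ?divr_gt0//.
  rewrite ltr_pdivrMr// ltr_pMr// ltr1n => /(_ isT).
  by rewrite sub0r normrN ler_norml => /andP[].
have t0 : t < 0 := lt_trans tts (cml_ts HL).
have y0 := slope_lt0 HL tts; set y := slope Lam mean t in y0 *.
(* The first bound keeps the window negative, the second makes [- t * ep] at most [e / 4]. *)
pose ep := Num.min (- y / 2) (e / (4 * - t)).
have ep0 : 0 < ep by rewrite lt_min !divr_gt0 ?oppr_gt0// mulr_gt0// oppr_gt0.
have epy : ep <= - y / 2 by rewrite ge_min lexx.
have ept : - t * ep <= e / 4.
  have : ep <= e / (4 * - t) by rewrite ge_min lexx orbT.
  rewrite ler_pdivlMr ?mulr_gt0 ?oppr_gt0//; lra.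
clearbody ep.
have := @continuous_slope _ _ _ _ HL t; rewrite /continuous_at -/y.
move=> /cvgrPdist_le/(_ (ep / 2)); rewrite divr_gt0// => /(_ isT)[r /= r0 hr].
have s0 : 0 < r / 2 by rewrite divr_gt0.
have rr : r / 2 < r by rewrite ltr_pdivrMr// ltr_pMr// ltr1n.
exists t, (r / 2), ep; split => //; [lra|].
rewrite -/y; split; [lra| |].
- have tr : t < t + r / 2 by rewrite ltrDl.
  have [z /andP[z1 z2] Ez] := rate_mvt HL tr.
  have : `|y - slope Lam mean z| <= ep / 2%:R.
    by apply: hr => /=; rewrite ltr_norml; lra.
  move: Ez; rewrite ler_norml -/phi => Ez /andP[h1 h2].
  have : slope Lam mean z * (t + r / 2 - t) <= (y + ep / 2) * (r / 2).
    by rewrite (_ : t + r / 2 - t = r / 2); [rewrite ler_wpM2r ?(ltW s0)//; lra|ring].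
  rewrite -Ez; lra.
- have tr : t - r / 2 < t by rewrite gtrBl.
  have [z /andP[z1 z2] Ez] := rate_mvt HL tr.
  have : `|y - slope Lam mean z| <= ep / 2%:R.
    by apply: hr => /=; rewrite ltr_norml; lra.
  move: Ez; rewrite ler_norml -/phi => Ez /andP[h1 h2].
  have : (y - ep / 2) * (r / 2) <= slope Lam mean z * (t - (t - r / 2)).
    by rewrite (_ : t - (t - r / 2) = r / 2); [rewrite ler_wpM2r ?(ltW s0)//; lra|ring].
  rewrite -Ez; lra.
Qed.

Let psi_cvg (t e : R) : 0 < e -> \forall dl \near 0^'+, \forall n \near \oo,
  `|dl * psi dl n t - phi t| <= e.
Proof. exact: (discounted_cumulant_cvg HL). Qed.

Let small_le (x y : R) : (forall e, 0 < e -> x <= y + e) -> x <= y.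
Proof. move=> h; apply/ler_addgt0Pr => e; exact: h. Qed.

Lemma prob_le0_upper (e : R) : 0 < e ->
  \forall dl \near 0^'+, p dl <= expR ((phi ts + e) / dl).
Proof.
move=> e0; have e2 : 0 < e / 2 by rewrite divr_gt0.
have ts0 := cml_ts HL.
(* Raising the threshold from 0 to [eta / dl] costs exactly [e / 2] in the rescaled Chernoff
   exponent; the other half goes to the Riemann sum. *)
pose eta := e / 2 / - ts.
have eta0 : 0 < eta by rewrite divr_gt0// oppr_gt0.
have etaE : ts * eta = - (e / 2) by rewrite /eta; field; rewrite lt_eqF.
have key := psi_cvg ts e2.
near=> dl.
have d0 : 0 < dl by near: dl; exact: nbhs_right_gt.
have d1 : dl < 1 by near: dl; exact: nbhs_right_lt.
have kd : \forall n \near \oo, `|dl * psi dl n ts - phi ts| <= e / 2.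
  by near: dl; exact: key.
(* From here on [dl] is fixed and only [n] grows, so the Egorov error [e'] can be arbitrarily
   small. *)
apply: small_le => e' e'0.
have d01 : 0 < dl < 1 by rewrite d0.
have cmp := compare d01 (divr_gt0 eta0 d0) e'0.
near \oo => n.
have [h _] : p dl <= q dl n (eta / dl) + e' /\ q dl n (- (eta / dl)) <= p dl + e'.
  by near: n; exact: cmp.
have hn : `|dl * psi dl n ts - phi ts| <= e / 2 by near: n; exact: kd.
apply: (le_trans h); rewrite lerD2r.
apply: (le_trans (chernoff_le (mS dl n) (hS dl n) _ (ltW ts0))).
rewrite -expRD ler_expR ler_pdivlMr// mulrDl.
rewrite (_ : - (ts * (eta / dl)) * dl = e / 2); last first.
  by rewrite mulrA etaE; field; rewrite gt_eqF.
rewrite mulrC; move: hn; rewrite ler_norml; lra.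
Unshelve. all: by end_near. Qed.

Lemma prob_le0_lower (e : R) : 0 < e ->
  \forall dl \near 0^'+, expR ((phi ts - e) / dl) <= p dl.
Proof.
move=> e0; have e4 : 0 < e / 4 by rewrite divr_gt0.
have [t [s [ep [t0 s0 ep0 Lt [y0 hp hm]]]]] := exists_expR_window e4.
have sep0 : 0 < s * ep by rewrite mulr_gt0.
pose r := Num.min (s * ep / 8) (e / 4).
have r0 : 0 < r by rewrite lt_min !divr_gt0.
have r8 : r <= s * ep / 8 by rewrite ge_min lexx.
have re : r <= e / 4 by rewrite ge_min lexx orbT.
have [mn _] := rate_min HL t.
suff main dl : 0 < dl -> dl < 1 -> dl <= s * ep / 12 -> dl <= e / 4 ->
    (\forall n \near \oo, `|dl * psi dl n t - phi t| <= r) ->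
    (\forall n \near \oo, `|dl * psi dl n (t + s) - phi (t + s)| <= r) ->
    (\forall n \near \oo, `|dl * psi dl n (t - s) - phi (t - s)| <= r) ->
    expR ((phi ts - e) / dl) <= p dl.
  near=> dl; apply: main.
  - by near: dl; exact: nbhs_right_gt.
  - by near: dl; exact: nbhs_right_lt.
  - by near: dl; apply: nbhs_right_le; rewrite divr_gt0.
  - by near: dl; exact: nbhs_right_le.
  - by near: dl; exact: (psi_cvg t r0).
  - by near: dl; exact: (psi_cvg (t + s) r0).
  - by near: dl; exact: (psi_cvg (t - s) r0).
move=> d0 d1 ds de kd0 kdp kdm; apply: small_le => e' e'0.
have d01 : 0 < dl < 1 by rewrite d0.
(* The right end of the window is negative; its distance to 0, divided by [dl], is the margin spent
   in [compare]. *)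
have eta0 : 0 < - (slope Lam mean t + ep) by rewrite oppr_gt0.
have cmp := compare d01 (divr_gt0 eta0 d0) e'0.
have [n [[_ h] [hn0 [hnp hnm]]]] := filter_ex (filterI cmp (filterI kd0 (filterI kdp kdm))).
apply: le_trans h; rewrite mulNr opprK.
have := chernoff_ge (mS dl n) (hS dl n) ((slope Lam mean t - ep) / dl)
  ((slope Lam mean t + ep) / dl) (ltW t0) (ltW s0).
by apply: (exp_window_bound d0 ds de r8 re _ mn hp hm hn0 hnp hnm); rewrite (slopeM HL).
Unshelve. all: by end_near. Qed.

Lemma discounted_large_deviations :
  (fun dl : R => dl * ln (fine (P [set w |
     dl * limn (series (fun m => (1 - dl) ^+ m * X m w)) <= 0]))) @ 0^'+ --> phi ts.
Proof.
apply/cvgrPdist_le => e e0.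
have up := prob_le0_upper e0; have lo := prob_le0_lower e0.
near=> dl.
have d0 : 0 < dl by near: dl; exact: nbhs_right_gt.
rewrite (_ : [set w | _] = E dl); last first.
  by apply/seteqP; split => w; rewrite /E /S /= pmulr_rle0.
have h1 : p dl <= expR ((phi ts + e) / dl) by near: dl; exact: up.
have h2 : expR ((phi ts - e) / dl) <= p dl by near: dl; exact: lo.
have p0 : 0 < p dl := lt_le_trans (expR_gt0 _) h2.
rewrite -/(p dl).
have {}h1 : ln (p dl) * dl <= phi ts + e.
  by rewrite -ler_pdivlMr// -[leRHS]expRK ler_ln ?posrE ?expR_gt0.
have {}h2 : phi ts - e <= ln (p dl) * dl.
  by rewrite -ler_pdivrMr// -[leLHS]expRK ler_ln ?posrE ?expR_gt0.
rewrite ler_norml; lra.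
Unshelve. all: by end_near. Qed.

End LargeDeviations.

(** * Signals of an agent *)

Lemma ge0_integral_eq0_ae {R : realType} {d} {T : measurableType d} (nu : {measure set T -> \bar R})
    (g : T -> R) : measurable_fun setT g -> (forall x, 0 <= g x) ->
  (\int[nu]_x (g x)%:E = 0)%E -> {ae nu, forall x, g x = 0}.
Proof.
move=> mg g0 I0.
have /(ae_eq_integral_abs nu measurableT) : measurable_fun setT (EFin \o g).
  exact/measurable_EFinP.
move=> [+ _]; under eq_integral => x _ do rewrite /= ger0_norm//.
move=> /(_ I0); by apply: filterS => x /(_ Logic.I)[].
Qed.

Section AgentSignals.
Context {R : realType} {N H : nat} (S : model R N H).
Context {dO : measure_display} {Omega : measurableType dO}.
Context (P : probability Omega R) (xi : forall k : 'I_N, nat -> Omega -> Defs.X S k).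
Hypotheses (HA : standing_assumptions S) (HS : signals P xi).
Variables (k : 'I_N) (th : 'I_H.+1).
Hypothesis th1 : th != theta1.

Let mf : measurable_fun [set: Defs.X S k] (@Defs.f _ _ _ S k).
Proof. by have [] := f_density HA k. Qed.

Let f0 s : 0 <= @Defs.f _ _ _ S k s.
Proof. by have [_ + _] := f_density HA k; apply. Qed.

Let mL t : measurable_fun [set: Defs.X S k] (@Defs.L _ _ _ S k t).
Proof. by have [] := L_density HA k t. Qed.

Let L0 t s : 0 <= @Defs.L _ _ _ S k t s.
Proof. by have [_ + _] := L_density HA k t; apply. Qed.

Let mxi m : measurable_fun setT (xi k m).
Proof. exact: (signal_measurable HS). Qed.

(** Off the support all likelihoods vanish, and both sides are 0 by the conventions for division and
    [ln] at 0. *)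
Lemma llrE (s : Defs.X S k) : llr th s = ln (L theta1 s) - ln (L th s).
Proof.
rewrite /llr; have [f0s|f0s] := eqVneq (@Defs.f _ _ _ S k s) 0.
  have L1 t : @Defs.L _ _ _ S k t s = 0.
    by apply/eqP; rewrite (same_support HA) f0s.
  by rewrite !L1 mul0r ln0// subrr.
have L1 t : 0 < @Defs.L _ _ _ S k t s by rewrite lt_neqAle eq_sym (same_support HA) f0s L0.
by rewrite ln_div ?posrE.
Qed.

Lemma measurable_llr : measurable_fun setT (@llr _ _ _ S k th).
Proof.
rewrite (_ : @llr _ _ _ S k th = fun s => ln (L theta1 s) - ln (L th s)); last exact/funext/llrE.
apply: measurable_funB; (apply: measurableT_comp; first exact: measurable_ln); exact: mL.
Qed.

Lemma law_expect m (h : Defs.X S k -> R) : measurable_fun setT h -> (forall s, 0 <= h s) ->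
  (\int[P]_w (h (xi k m w))%:E = expect h)%E.
Proof.
move=> mh h0.
have := @eq_weighted_law R _ _ _ _ _ _ P (Defs.mu S k) (cst 1) (@Defs.f _ _ _ S k)
  (xi k m) id h (measurable_cst _) _ (mxi m) mf f0 (@measurable_id _ _ _) _ mh h0.
under eq_integral do rewrite mul1r.
apply => // B mB.
under eq_integral do rewrite mul1r.
transitivity (P (xi k m @^-1` B)).
  rewrite (_ : \int[P]_w _ = \int[P]_w (\1_(xi k m @^-1` B) w)%:E)%E//.
  rewrite integral_indic ?setIT// -[X in measurable X]setTI; exact: mxi.
rewrite (signal_law HS)// [LHS]integral_mkcond; apply: eq_integral => s _.
by rewrite patchE indicE; case: ifP => _; rewrite ?mulr1 ?mulr0.
Qed.

Let Xr m w := llr th (xi k m w).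

Lemma measurable_Xr m : measurable_fun setT (Xr m).
Proof. by apply: measurableT_comp; [exact: measurable_llr|exact: mxi]. Qed.

Lemma mgf_signal m t : (mgf S k th t = \int[P]_w (expR (t * Xr m w))%:E)%E.
Proof.
rewrite (law_expect m (h := fun s => expR (t * llr th s)))//.
by apply: measurableT_comp => //; apply: measurable_funM => //; exact: measurable_llr.
Qed.

Lemma mgf_signal_fin m t : (\int[P]_w (expR (t * Xr m w))%:E < +oo)%E.
Proof. by rewrite -mgf_signal; exact: (mgf_finite HA). Qed.

Lemma Lambda_signal m t : Lambda S k th t = ln (\int[P]_w expR (t * Xr m w)).
Proof. by rewrite /Lambda (mgf_signal m). Qed.

Lemma mgf_signal_gt0 m t : 0 < \int[P]_w expR (t * Xr m w).
Proof. exact: (mgf_gt0 (measurable_Xr m) (mgf_signal_fin m)). Qed.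

Lemma expect_normr m : expect (fun s : Defs.X S k => `|llr th s|) =
  (\int[P]_w (`|Xr m w|)%:E)%E.
Proof.
rewrite -(law_expect m (h := fun s => `|llr th s|))//.
by apply: measurableT_comp => //; exact: measurable_llr.
Qed.

(** Transport of the law is available for nonnegative functions only, so [llr] is written as the
    difference of [h2], its sum with its absolute value, and that absolute value [h1]. *)
Lemma drift_signal m : drift S k th = \int[P]_w Xr m w.
Proof.
have iX := integrable_of_mgf (measurable_Xr m) (mgf_signal_fin m).
have mX := measurable_Xr m.
have mll := measurable_llr.
have iN := integrable_norm iX.
have E (h : Defs.X S k -> R) : measurable_fun setT h -> (forall s, 0 <= h s) ->
    P.-integrable setT (EFin \o (fun w => h (xi k m w))) ->
    (Defs.mu S k).-integrable setT (EFin \o (fun s => Defs.f s * h s)) /\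
    \int[Defs.mu S k]_s (Defs.f s * h s) = \int[P]_w h (xi k m w).
  move=> mh h0 ih; have e := law_expect m mh h0; split; last by rewrite /Rintegral e.
  apply/integrableP; split; first exact/measurable_EFinP/measurable_funM.
  under eq_integral => s _ do rewrite gee0_abs ?lee_fin ?mulr_ge0//.
  by rewrite -[X in (X < _)%E]e; exact: integrable_lty ih.
pose h1 := fun s : Defs.X S k => `|llr th s|.
pose h2 := fun s : Defs.X S k => llr th s + `|llr th s|.
have mh1 : measurable_fun setT h1 by exact: measurableT_comp.
have mh2 : measurable_fun setT h2 by exact: measurable_funD.
have h20 s : 0 <= h2 s by rewrite /h2 -lerBlDl sub0r -normrN ler_norm.
have [i1 e1] := E h1 mh1 (fun s => normr_ge0 _) iN.
have [i2 e2] : (Defs.mu S k).-integrable setT (EFin \o (fun s => Defs.f s * h2 s)) /\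
    \int[Defs.mu S k]_s (Defs.f s * h2 s) = \int[P]_w h2 (xi k m w).
  apply: E => //; under [X in _.-integrable _ X]eq_fun do rewrite /= EFinD.
  exact: integrableD.
transitivity (\int[Defs.mu S k]_s (Defs.f s * h2 s - Defs.f s * h1 s)).
  by apply: eq_Rintegral => s _; rewrite /h1 /h2; ring.
rewrite RintegralB// e1 e2 /h2 RintegralD// -/(Xr m) /h1.
by rewrite addrK.
Qed.

Lemma signals_iid_mgf n (a : nat -> R) :
  (\int[P]_w (expR (\sum_(m < n) a m * Xr m w))%:E =
   (expR (\sum_(m < n) Lambda S k th (a m)))%:E)%E.
Proof.
have ind n' (A : nat -> set (Defs.X S k)) : (forall m, measurable (A m)) ->
    (P (\big[setI/setT]_(m < n') (xi k m @^-1` A m)) =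
     \prod_(m < n') P (xi k m @^-1` A m))%E.
  move=> mA.
  (* Independence is stated for sets indexed by all agents, in spaces that depend on the agent: [A]
     is transported to agent [k] and the other agents, absent from the list [J], get the empty
     set. *)
  pose A' (l : 'I_N) (m : nat) : set (Defs.X S l) :=
    match k =P l with
    | ReflectT e => eq_rect k (fun j => set (Defs.X S j)) (A m) l e
    | ReflectF _ => set0
    end.
  have A'E m : A' k m = A m.
    by rewrite /A'; case: (k =P k) => // e; rewrite (eq_irrelevance e erefl).
  have mA' l m : measurable (A' l m).
    rewrite /A'; case: (k =P l) => [e|_]; last exact: measurable0.
    by case: l / e => /=.
  have := signal_independent HS (J := [seq (k, m) | m <- iota 0 n']) (A := A').
  rewrite !big_map/= => h.
  have uJ : uniq [seq (k, m) | m <- iota 0 n'].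
    by rewrite map_inj_uniq ?iota_uniq// => i j [].
  have := h uJ mA'; under eq_bigr do rewrite A'E; under [RHS]eq_bigr do rewrite A'E.
  by rewrite -[n' in iota 0 n']subn0 -/(index_iota 0 n') !big_mkord.
have := @integral_prod_indep R _ _ P _ _ (xi k) mxi ind
  (fun m s => expR (a m * llr th s)) n _ _ _.
under eq_integral do rewrite -expR_sum.
move=> ->.
- rewrite expR_sum -prodEFin; apply: eq_bigr => m _.
  rewrite (Lambda_signal m) lnK ?posrE ?mgf_signal_gt0// fineK// ge0_fin_numE.
    exact: mgf_signal_fin.
  by apply: integral_ge0 => w _; rewrite lee_fin expR_ge0.
- move=> m; apply: measurableT_comp => //; apply: measurable_funM => //.
  exact: measurable_llr.
- by move=> m s; exact: expR_ge0.
- by move=> m; exact: mgf_signal_fin.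
Qed.

(** The moment generating function is 1 at both 1 and -1, so [expR X + expR (- X) - 2] has integral
    0; it is nonnegative and vanishes only at [X = 0]. *)
Lemma uninformative_ae0 m : uninformative S th k -> {ae P, forall w, Xr m w = 0}.
Proof.
move=> U; have mX := measurable_Xr m; have hX := mgf_signal_fin m.
have M1 t : \int[P]_w expR (t * Xr m w) = 1.
  rewrite -[LHS]lnK ?posrE ?mgf_signal_gt0//.
  by rewrite -Lambda_signal U expR0.
have iE t := integrable_expRM mX hX t.
have iD : P.-integrable setT (EFin \o (fun w => expR (1 * Xr m w) + expR (-1 * Xr m w))).
  under [X in _.-integrable _ X]eq_fun do rewrite /= EFinD.
  exact: (integrableD measurableT (iE _) (iE _)).
have i2 : P.-integrable setT (EFin \o (fun=> 2 : R)).
  exact: finite_measure_integrable_cst.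
pose g w := expR (1 * Xr m w) + expR (-1 * Xr m w) - 2.
have ig : P.-integrable setT (EFin \o g).
  under [X in _.-integrable _ X]eq_fun do rewrite /= EFinB.
  exact: integrableB.
have g0 w : 0 <= g w.
  rewrite /g mul1r mulN1r; have := expR_ge1Dx (Xr m w); have := expR_ge1Dx (- Xr m w).
  lra.
have Ig : (\int[P]_w (g w)%:E = 0)%E.
  rewrite -[LHS]fineK; last exact: integrable_fin_num ig.
  congr _%:E; rewrite -/(Rintegral P setT g) /g RintegralB// RintegralD//.
  rewrite !M1 Rintegral_cst//= probability_setT/=; ring.
have mg : measurable_fun setT g by apply/measurable_EFinP; exact: measurable_int ig.
apply: filterS (ge0_integral_eq0_ae mg g0 Ig) => w.
rewrite /g mul1r mulN1r => gw; apply/eqP; apply: contrapT => /negP X0.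
have := expR_gt1Dx X0; have := expR_ge1Dx (- Xr m w); lra.
Qed.

Lemma uninformative_drift : uninformative S th k -> drift S k th = 0.
Proof.
move=> /(uninformative_ae0 0) U; rewrite (drift_signal 0) /Rintegral.
rewrite (ae_eq_integral (cst 0%E))//.
- by rewrite integral0.
- exact/measurable_EFinP/measurable_Xr.
- by apply: filterS U => w /= -> _.
Qed.

(** The discounted sum is almost surely 0 and the inequality in [nc_event] is not strict: the event
    has probability 1. *)
Lemma uninformative_Phi_nc : uninformative S th k -> Phi_nc P xi k th = 0.
Proof.
move=> U; rewrite /Phi_nc (_ : lim _ = 0) ?oppr0//.
apply: cvg_lim => //; apply/cvgrPdist_le => e e0.
near=> dl.
have d0 : 0 < dl by near: dl; exact: nbhs_right_gt.
have mX m := measurable_Xr m.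
pose E := nc_event xi k th dl.
have mE : measurable E.
  rewrite /E /nc_event (_ : [set w | _] =
    [set w | limn (fun n => series (fun m => (1 - dl) ^+ m * Xr m w) n) <= 0]); last first.
    by apply/seteqP; split => w; rewrite /= pmulr_rle0.
  apply: measurable_limn_le => n; rewrite /series/=; apply: measurable_sum => m.
  exact: measurable_funM.
have PE : P E = 1%E.
  have : {ae P, forall w, forall m, Xr m w = 0}.
    by apply: ae_foralln => m; exact: uninformative_ae0.
  move=> [D [mD PD sD]].
  apply/eqP; rewrite eq_le probability_le1//=.
  have := probability_setC P mE.
  rewrite (@subset_measure0 _ _ _ P (~` E) D (measurableC mE) mD _ PD); last first.
    move=> w nE; apply: sD => /= X0; apply: nE; rewrite /E /nc_event/=.
    rewrite (_ : (fun m => _) = cst 0); last first.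
      by apply/funext => m; rewrite -/(Xr m w) X0 mulr0.
    rewrite (_ : series _ = cst 0) ?lim_cst ?mulr0//.
    by apply/funext => n; rewrite /series/= big1.
  have fE : P E \is a fin_num by rewrite fin_num_measure.
  rewrite -(fineK fE) -EFinB => -[h].
  by rewrite (_ : fine (P E) = 1)//; lra.
by rewrite -/E PE /= ln1 mulr0 subrr normr0 ltW.
Unshelve. all: by end_near. Qed.

(* Otherwise [L theta1 >= L th] almost everywhere, and two densities so ordered
   are equal almost everywhere. *)
Lemma negative_part_signal_gt0 m : 0 < drift S k th ->
  0 < \int[P]_w Num.max (- Xr m w) 0.
Proof.
move=> d0; rewrite lt_neqAle; apply/andP; split; last first.
  by apply: Rintegral_ge0 => w _; rewrite le_max lexx orbT.
apply/eqP => I0.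
have mll := measurable_llr.
have mneg : measurable_fun setT (fun s : Defs.X S k => Num.max (- llr th s) 0).
  by apply: measurable_maxr => //; exact: measurableT_comp.
have neg0 (s : Defs.X S k) : 0 <= Num.max (- llr th s) 0 by rewrite le_max lexx orbT.
have iX := integrable_of_mgf (measurable_Xr m) (mgf_signal_fin m).
have ineg : P.-integrable setT (EFin \o (fun w => Num.max (- Xr m w) 0)).
  apply: le_integrable iX => //.
    by apply/measurable_EFinP; apply: (measurableT_comp mneg).
  move=> w _ /=; rewrite lee_fin ger0_norm ?le_max ?lexx ?orbT//.
  by rewrite ge_max normr_ge0 andbT -normrN ler_norm.
have {}I0 : expect (fun s : Defs.X S k => Num.max (- llr th s) 0) = 0%E.
  rewrite -(law_expect m mneg neg0) -[LHS]fineK; last exact: integrable_fin_num ineg.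
  by congr _%:E.
have ae1 : {ae Defs.mu S k, forall s, Defs.f s * Num.max (- llr th s) 0 = 0}.
  apply: ge0_integral_eq0_ae I0; first exact: measurable_funM.
  by move=> s; exact: mulr_ge0.
have iL t : (Defs.mu S k).-integrable setT (EFin \o (@Defs.L _ _ _ S k t)).
  apply/integrableP; split; first exact/measurable_EFinP.
  under eq_integral => s _ do rewrite gee0_abs ?lee_fin ?L0//.
  by have [_ _ ->] := L_density HA k t; rewrite ltry.
pose D (s : Defs.X S k) := L theta1 s - L th s.
have mD : measurable_fun setT D by exact: measurable_funB.
have iD : (Defs.mu S k).-integrable setT (EFin \o D).
  under [X in _.-integrable _ X]eq_fun do rewrite /= EFinB.
  exact: (integrableB measurableT (iL _) (iL _)).
have ID : (\int[Defs.mu S k]_s (D s)%:E = 0)%E.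
  under eq_integral do rewrite EFinB.
  rewrite integralB_EFin//; have [_ _ ->] := L_density HA k th.
  by have [_ _ ->] := L_density HA k theta1; rewrite subee.
have D0 : {ae Defs.mu S k, forall s, 0 <= D s}.
  apply: filterS ae1 => s; rewrite /D subr_ge0.
  have [fs|fs] := eqVneq (Defs.f s) 0.
    have L1 t : @Defs.L _ _ _ S k t s = 0.
      by apply/eqP; rewrite (same_support HA) fs.
    by rewrite !L1.
  have L1 t : 0 < @Defs.L _ _ _ S k t s.
    by rewrite lt_neqAle eq_sym (same_support HA) fs L0.
  move=> /eqP; rewrite mulf_eq0 (negbTE fs)/= => /eqP h.
  have : - llr th s <= 0 by rewrite -h le_max lexx.
  by rewrite oppr_le0 llrE subr_ge0 ler_ln ?posrE.
have D00 : {ae Defs.mu S k, forall s, `|D s| = 0}.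
  apply: ge0_integral_eq0_ae => //; first exact: measurableT_comp.
  rewrite -ID; apply: ae_eq_integral => //.
  - by apply/measurable_EFinP; exact: measurableT_comp.
  - exact/measurable_EFinP.
  - by apply: filterS D0 => s h _; rewrite ger0_norm.
have : drift S k th = 0.
  rewrite /drift /expect (ae_eq_integral (cst 0%E)) ?integral0//.
    by apply/measurable_EFinP; exact: measurable_funM.
  apply: filterS D00 => s /eqP; rewrite normr_eq0 subr_eq0 => /eqP h _ /=.
  by rewrite llrE h subrr mulr0.
by move=> dE; rewrite dE ltxx in d0.
Qed.

Lemma informative_cumulant : informative S th k ->
  exists ts, cumulant_like (Lambda S k th) (drift S k th) ts.
Proof.
move=> [_ d0]; have mX := measurable_Xr 0; have hX := mgf_signal_fin 0.
have [ts h] := cumulant_like_ln (continuous_mgf mX hX) (mgf0 P (Xr 0)) (is_derive_mgf0 mX hX)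
  (eq_ind _ (fun x => 0 < x) d0 _ (drift_signal 0)) (negative_part_signal_gt0 0 d0)
  (mgf_signal_gt0 0) (mgf_ge1 mX hX) (mgf_ge_neg mX hX) (mgf_convex mX hX).
exists ts; rewrite (drift_signal 0) (_ : Lambda S k th =
  (fun t => ln (\int[P]_w expR (t * Xr 0 w))))//.
by apply/funext => t; exact: Lambda_signal.
Qed.

Lemma informative_Phi_nc ts : cumulant_like (Lambda S k th) (drift S k th) ts ->
  Phi_nc P xi k th = - rate (Lambda S k th) (drift S k th) ts.
Proof.
move=> HL; congr (- _); apply: cvg_lim => //.
have iX := integrable_of_mgf (measurable_Xr 0) (mgf_signal_fin 0).
apply: (@discounted_large_deviations R _ Omega P Xr _ _ _ (\int[P]_w `|Xr 0 w|)) => //.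
- exact: measurable_Xr.
- exact: signals_iid_mgf.
- move=> m; rewrite -expect_normr (expect_normr 0) fineK//.
  exact: integrable_fin_num (integrable_norm iX).
Qed.

Lemma informative_t_nc C ts : informative S th k ->
  cumulant_like (Lambda S k th) (drift S k th) ts -> t_nc S C k th = ts.
Proof.
move=> /asboolP I HL; rewrite /t_nc I.
have := @getPex R [set t : R | t != 0 /\ Lambda S k th t = 0].
case.
  by exists ts; split; [rewrite lt_eqF// (cml_ts HL)|exact: (cml_root HL)].
by move=> t0 Lt; exact: (cml_ts_unique HL).
Qed.

End AgentSignals.

(** * Optimal weights *)

Section Optimisation.
Context {R : realType}.

Lemma inf_eq_min (E : set R) (x : R) : E x -> (forall y, E y -> x <= y) -> inf E = x.
Proof.
move=> Ex lbx; apply/eqP; rewrite eq_le; apply/andP; split.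
  by apply: ge_inf => //; exists x.
by apply: lb_le_inf => //; exists x.
Qed.

Lemma extend0_continuous (h G : R -> R) : continuous G ->
  (forall x, x != 0 -> h x = G x) -> extend0 h = G.
Proof.
move=> cG hG; apply/funext => x; rewrite /extend0; case: eqVneq => [->|/hG//].
apply: cvg_lim => //; apply: cvg_trans (cvg_within_filter _ (cG 0)).
apply: near_eq_cvg; near=> y; rewrite hG//.
by near: y; exact: nbhs_dnbhs_neq.
Unshelve. all: by end_near. Qed.

Lemma continuous_sum (N : nat) (F : 'I_N -> R -> R) :
  (forall k, continuous (F k)) -> continuous (fun t => \sum_k F k t).
Proof.
move=> cF; apply: continuous_big => [|k _]; last exact: cF.
exact: add_continuous.
Qed.

(* Each summand is nonincreasing before its critical point and nondecreasing
   after it, so the minimum over a large segment is global. *)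
Lemma sum_unimodal_min (N : nat) (F : 'I_N -> R -> R) (a : 'I_N -> R) :
  (forall k, continuous (F k)) ->
  (forall k s t, s <= t -> t <= a k -> F k t <= F k s) ->
  (forall k s t, s <= t -> a k <= s -> F k s <= F k t) ->
  exists t0, forall t, \sum_k F k t0 <= \sum_k F k t.
Proof.
move=> cF dF iF; pose T := \sum_k `|a k|.
have T0 : 0 <= T by apply: sumr_ge0.
have aT k : - T <= a k <= T.
  rewrite -ler_norml /T (bigD1 k)//= lerDl; exact: sumr_ge0.
have cS : continuous (fun t => \sum_k F k t).
  exact: continuous_sum.
have [|c _ cmin] := @EVT_min R (fun t => \sum_k F k t) (- T) T _ (continuous_subspaceT cS).
  by lra.
exists c => t; have [tT|Tt] := leP t (- T).
  apply: (@le_trans _ _ (\sum_k F k (- T))).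
    by apply: cmin; rewrite in_itv/= lexx; lra.
  by apply: ler_sum => k _; apply: dF => //; have /andP[] := aT k.
have [tT'|Tt'] := leP t T.
  by apply: cmin; rewrite in_itv/= tT' ltW.
apply: (@le_trans _ _ (\sum_k F k T)).
  by apply: cmin; rewrite in_itv/= lexx; lra.
by apply: ler_sum => k _; apply: iF; [exact: ltW|have /andP[] := aT k].
Qed.

End Optimisation.

(** * The upper bound for feasible weights and its equality case *)

Section ExponentBound.
Context {R : realType} {N H : nat} (S : model R N H).
Context {dO : measure_display} {Omega : measurableType dO}.
Context (P : probability Omega R) (xi : forall k : 'I_N, nat -> Omega -> Defs.X S k).
Context (C : 'I_N -> 'I_H.+1 -> R) (thd : 'I_H.+1).
Hypotheses (HA : standing_assumptions S) (HS : signals P xi).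
Hypothesis C0 : forall k th, 0 < C k th.
Hypothesis th1 : thd != theta1.
Hypothesis noconf : forall k, ~ conflicting S thd k.

Let Lam k := Lambda S k thd.
Let dr k := drift S k thd.
Let inf_k k := informative S thd k.
Let tn k := t_nc S C k thd.
Let phi_k k := rate (Lam k) (dr k).

(** The absence of conflicting agents enters here: every [phi_k] either has a negative minimizer or
    vanishes identically. *)
Let inf_or_uninf k : inf_k k \/ uninformative S thd k.
Proof.
have [U|nU] := pselect (uninformative S thd k); [by right|left].
split=> //; rewrite ltNge; apply/negP => d0; exact: (noconf (conj nU d0)).
Qed.

Let cml k : inf_k k -> cumulant_like (Lam k) (dr k) (tn k).
Proof.
move=> I; have [ts h] := informative_cumulant HA HS th1 I.
by rewrite /tn (informative_t_nc C I h).
Qed.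

Let uninf_slope k : uninformative S thd k -> slope (Lam k) (dr k) = cst 0.
Proof.
move=> U; apply/funext => x; rewrite /slope /dr (uninformative_drift HA HS th1 U).
by rewrite /Lam U mul0r; case: ifP.
Qed.

Let slope_cont k : continuous (slope (Lam k) (dr k)).
Proof.
have [I|U] := inf_or_uninf k; first exact: (continuous_slope (cml I)).
by rewrite uninf_slope//; exact: cst_continuous.
Qed.

Let phi_deriv k (t : R) : is_derive t (1 : R) (phi_k k) (slope (Lam k) (dr k) t).
Proof. exact: is_derive_integral0. Qed.

Let phi_cont k : continuous (phi_k k).
Proof. exact: continuous_integral0. Qed.

Let phi_uninf k t : uninformative S thd k -> phi_k k t = 0.
Proof.
move=> U; apply: (@integral0_unique R _ (cst 0)) => // x.
by rewrite uninf_slope//; exact: is_derive_cst.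
Qed.

(** For uninformative agents the sign comes from [C]; it keeps the denominator of [pi_dagger]
    negative. *)
Let tn_lt0 k : tn k < 0.
Proof.
have [I|U] := inf_or_uninf k; first exact: (cml_ts (cml I)).
rewrite /tn /t_nc; case: asboolP => [[]//|_]; rewrite (asboolT U).
by rewrite oppr_lt0.
Qed.

Let phi_min k t : phi_k k (tn k) <= phi_k k t.
Proof.
have [I|U] := inf_or_uninf k; last by rewrite !phi_uninf.
exact: (rate_min (cml I) t).
Qed.

Let Phi_nc_E k : Phi_nc P xi k thd = - phi_k k (tn k).
Proof.
have [I|U] := inf_or_uninf k; first exact: (informative_Phi_nc HA HS th1 (cml I)).
by rewrite phi_uninf// oppr0; exact: (uninformative_Phi_nc HA HS th1 U).
Qed.

Let V := Phi_nc_sum P xi thd.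
Let VE : V = - \sum_k phi_k k (tn k).
Proof. by rewrite -sumrN; apply: eq_bigr => k _; rewrite Phi_nc_E. Qed.

Section FeasibleWeights.
Variable p : 'rV[R]_N.
Hypothesis pPi : Pi S p.

Let p0 k : 0 < p ord0 k. Proof. by have [_ + _] := pPi. Qed.

Let F t := \sum_k phi_k k (p ord0 k * t).

(** In place of a substitution in the integral, [F] is recognised as the primitive of [G] that
    vanishes at 0. *)
Let phiE : phi S p thd = F.
Proof.
pose G (x : R) := \sum_k p ord0 k * slope (Lam k) (dr k) (p ord0 k * x).
have cG : continuous G.
  apply: continuous_sum => k x; apply: cvgM; first exact: cvg_cst.
  apply: continuous_comp; last exact: slope_cont.
  by apply: cvgM; [exact: cvg_cst|exact: cvg_id].
have EG : extend0 (fun x => Lambda_ave S p thd x / x) = G.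
  apply: extend0_continuous => // x x0.
  rewrite /Lambda_ave mulr_suml; apply: eq_bigr => k _.
  rewrite /slope mulf_eq0 (negbTE x0) gt_eqF//= -/(Lam k).
  by field; rewrite x0 gt_eqF.
apply/funext => t; rewrite /phi EG.
apply: integral0_unique => //.
- move=> x; rewrite (_ : F = \sum_k (phi_k k \o ( *%R (p ord0 k)))); last first.
    by apply/funext => y; rewrite fct_sumE.
  apply: is_derive_sum => k; rewrite mulrC.
  apply: is_derive1_comp; first exact: phi_deriv.
  have := is_deriveZ (p ord0 k) (is_derive_id x (1 : R)).
  by rewrite /GRing.scale/= mulr1.
- by rewrite /F big1// => k _; rewrite mulr0 /phi_k rate0.
Qed.

(** An attained minimum settles that [inf] is taken over a set bounded below, and supplies the
    common parameter [t0] for the equality case. *)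
Let F_min : exists t0, forall t, F t0 <= F t.
Proof.
apply: (@sum_unimodal_min R N (fun k t => phi_k k (p ord0 k * t)) (fun k => tn k / p ord0 k)).
- move=> k t; apply: continuous_comp; last exact: phi_cont.
  by apply: cvgM; [exact: cvg_cst|exact: cvg_id].
- move=> k s t st; rewrite ler_pdivlMr// mulrC => ta.
  have [I|U] := inf_or_uninf k; last by rewrite !phi_uninf.
  move: st; rewrite le_eqVlt => /predU1P[->//|st].
  by apply/ltW/(rate_decr (cml I)) => //; rewrite ltr_pM2l.
- move=> k s t st; rewrite ler_pdivrMr// mulrC => ta.
  have [I|U] := inf_or_uninf k; last by rewrite !phi_uninf.
  move: st; rewrite le_eqVlt => /predU1P[->//|st].
  by apply/ltW/(rate_incr (cml I)) => //; rewrite ltr_pM2l.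
Qed.

Let Phi_thE t0 : (forall t, F t0 <= F t) -> Phi_th S p thd = - F t0.
Proof.
move=> h; rewrite /Phi_th phiE; congr (- _); apply: inf_eq_min.
  by exists t0.
by move=> _ [t _ <-].
Qed.

Lemma Phi_th_le_nc : Phi_th S p thd <= V.
Proof.
have [t0 h] := F_min; rewrite (Phi_thE h) VE lerN2.
by apply: ler_sum => k _.
Qed.

(** Uninformative agents have drift 0, so without an informative one the weighted drift would be 0,
    against feasibility. *)
Let exists_inf : exists k, inf_k k.
Proof.
apply: contrapT => h; have [_ _ /(_ thd th1)] := pPi.
rewrite big1 ?ltxx// => k _.
have [I|U] := inf_or_uninf k; first by exfalso; apply: h; exists k.
by rewrite (uninformative_drift HA HS th1 U) mulr0.
Qed.

Lemma Phi_th_eq_nc : Phi_th S p thd = V <-> Pi_2 S C thd p.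
Proof.
pose s := \sum_l tn l.
have s0 : s < 0.
  have [k _] := exists_inf; rewrite /s (bigD1 k)//= ltr_wnDr//.
  by apply: sumr_le0 => l _; exact: ltW.
split.
- have [t0 h] := F_min; rewrite (Phi_thE h) VE => /oppr_inj E.
  have eqk k : phi_k k (p ord0 k * t0) = phi_k k (tn k).
    apply/eqP; rewrite -subr_eq0; apply/eqP.
    have := @psumr_eq0P R _ xpredT (fun k => phi_k k (p ord0 k * t0) - phi_k k (tn k)).
    apply => // [l _|]; first by rewrite subr_ge0.
    by rewrite sumrB; apply/eqP; rewrite subr_eq0; apply/eqP.
  have pk k : inf_k k -> p ord0 k * t0 = tn k.
    move=> I; have [_ e] := rate_min (cml I) (p ord0 k * t0).
    by apply/eqP; rewrite -e -/(phi_k k) eqk.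
  have t00 : t0 < 0.
    have [k I] := exists_inf; have := tn_lt0 k; rewrite -(pk k I).
    by rewrite pmulr_rlt0.
  (* Since [p ord0 k = tn k / t0], normalising by [s] leaves the factor [s / t0]. *)
  exists (s / t0); first by rewrite nmulr_lgt0 ?invr_lt0.
  move=> k nU; have [I|//] := inf_or_uninf k.
  rewrite /pi_dagger -/(tn k) -/tn -/s -(pk k I).
  by field; rewrite !lt_eqF.
- move=> [al al0 hp].
  (* At [s / al] every informative agent sits at its critical value. *)
  have Fs : F (s / al) = \sum_k phi_k k (tn k).
    apply: eq_bigr => k _; have [I|U] := inf_or_uninf k; last by rewrite !phi_uninf.
    rewrite hp; last by case: I.
    rewrite /pi_dagger -/(tn k) -/s; congr (phi_k k _).
    by field; rewrite ?(lt_eqF s0) ?(gt_eqF al0).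
  rewrite (@Phi_thE (s / al)) ?Fs ?VE// => t.
  by apply: ler_sum.
Qed.

Lemma Phi_le_Phi_th th : th != theta1 -> Phi S p <= Phi_th S p th.
Proof.
move=> tht; rewrite /Phi; apply: ge_inf; last by exists th.
exists (- \sum_th `|Phi_th S p th|) => _ [th' _ <-].
rewrite lerNl (bigD1 th')//= (le_trans (ler_norm _))// normrN lerDl.
exact: sumr_ge0.
Qed.

Lemma Phi_le_nc : Phi S p <= V.
Proof. exact: le_trans (Phi_le_Phi_th th1) Phi_th_le_nc. Qed.

(** In the chain [Phi S p <= Phi_th S p thd <= V], equality of the ends forces both: the left one
    gives [Pi_1], the right one [Pi_2]. *)
Lemma Phi_eq_nc : Phi S p = V <-> Pi_dagger S C thd p.
Proof.
split=> [E|[[_ h1] /Phi_th_eq_nc h2]]; last first.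
  rewrite -h2 /Phi; apply: inf_eq_min; first by exists thd.
  by move=> _ [th /= tht <-]; exact: h1.
have ET : Phi_th S p thd = V.
  by apply/eqP; rewrite eq_le Phi_th_le_nc -E Phi_le_Phi_th.
split; last exact/Phi_th_eq_nc.
split=> [|th tht]; first exact: pPi.
by rewrite ET -E; exact: Phi_le_Phi_th.
Qed.

End FeasibleWeights.
End ExponentBound.

Unset Implicit Arguments.

Theorem theorem1p1 (R : realType) (N H : nat) (S : model R N H)
    (dO : measure_display) (Omega : measurableType dO)
    (P : probability Omega R)
    (xi : forall k : 'I_N, nat -> Omega -> X S k)
    (C : 'I_N -> 'I_H.+1 -> R) (thd : 'I_H.+1) :
  standing_assumptions S ->
  signals P xi ->
  (forall k th, 0 < C k th) ->
  unique_minimizer P xi thd ->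
  (forall k, ~ conflicting S thd k) ->
  (Pi_dagger S C thd !=set0 ->
     is_max_exponent S (Phi_nc_sum P xi thd) /\
     Pi_star S = Pi_dagger S C thd) /\
  (Pi_dagger S C thd = set0 ->
     (forall p, Pi S p -> Phi S p < Phi_nc_sum P xi thd) /\
     (forall Phi_max : R, is_max_exponent S Phi_max ->
        Phi_max < Phi_nc_sum P xi thd)).
Proof.
move=> HA HS C0 [th1 _] noconf.
have leV p : Pi S p -> Phi S p <= Phi_nc_sum P xi thd.
  exact: (Phi_le_nc C HA HS th1 noconf).
have eqV p : Pi S p -> Phi S p = Phi_nc_sum P xi thd <-> Pi_dagger S C thd p.
  exact: (Phi_eq_nc HA HS C0 th1 noconf).
have sub p : Pi_dagger S C thd p -> Pi S p by case=> [[]].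
split=> [[p0 dp0]|d0].
  have Pp0 := sub p0 dp0; have E0 := (eqV p0 Pp0).2 dp0.
  split; first by split=> //; exists p0.
  apply/seteqP; split=> p.
    move=> [Pp /(_ p0 Pp0) h]; apply: (eqV p Pp).1.
    by apply: le_anti; rewrite (leV p Pp) -E0 h.
  move=> dp; split=> [|q Pq]; first exact: sub.
  by rewrite ((eqV p (sub p dp)).2 dp); exact: leV.
have ltV p : Pi S p -> Phi S p < Phi_nc_sum P xi thd.
  move=> Pp; rewrite lt_neqAle (leV p Pp) andbT; apply/eqP => h.
  by have := (eqV p Pp).1 h; rewrite d0.
split; first exact: ltV.
(* A maximum is attained at some feasible [p], so the pointwise strict inequality passes to it. *)
by move=> _ [[p Pp <-] _]; exact: ltV.
Qed.
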